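(* For every integer $d\ge 4$ there exist an integer $k\ge 1$ and points $s_1,\dots,s_k\in\mathbb{Z}^d$ such that the finite union of unit cubes $$\Omega=\bigcup_{j=1}^k \left(s_j+[0,1)^d\right)\subset\mathbb{R}^d$$ is spectral but is not a tile of $\mathbb{R}^d$.
   Context: Let $\Omega\subset\mathbb{R}^d$ be a Lebesgue measurable set of finite non-zero measure $|\Omega|$. A set $\Lambda\subset\mathbb{R}^d$ is a spectrum of $\Omega$ if the functions $x\mapsto \frac{1}{|\Omega|^{1/2}}e^{2\pi i\langle x,\xi\rangle}$, $\xi\in\Lambda$, form an orthonormal basis of $L^2(\Omega)$. The set $\Omega$ is called spectral if it has a spectrum. The set $\Omega$ is called a (translational) tile if there is a set $\Sigma\subset\mathbb{R}^d$ such that the translates $\{t+\Omega : t\in\Sigma\}$ tile $\mathbb{R}^d$, ignoring overlaps and gaps of measure zero (i.e. distinct translates intersect in measure zero and the union of the translates has complement of measure zero). *)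

(* Defs.v *)
From HB Require Import structures.
From mathcomp Require Import all_boot all_order all_algebra.
From mathcomp Require Import complex.
From mathcomp Require Import all_classical all_reals all_analysis.

Set Implicit Arguments.
Unset Strict Implicit.
Unset Printing Implicit Defensive.
Import Order.TTheory GRing.Theory Num.Theory.
Import numFieldNormedType.Exports.

Local Open Scope classical_set_scope.
Local Open Scope ring_scope.

(* R^d carries the product of the d Borel sigma-algebras. *)
Notation rvec R d := (d.-tuple (measurableTypeR R)).

Section lebesgue_measure_step.
Context (R : realType) (n : nat).
Variable mu : {sigma_finite_measure set (rvec R n) -> \bar R}.

Definition vcons (p : measurableTypeR R * rvec R n) : rvec R n.+1 :=
  [tuple of p.1 :: p.2].

Lemma measurable_vcons : measurable_fun [set: measurableTypeR R * rvec R n] vcons.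
Proof. by apply: measurable_cons. Qed.

Definition lebesgue_step : set (rvec R n.+1) -> \bar R :=
  pushforward (lebesgue_measure \x mu)%E vcons.

Let lebesgue_step0 : lebesgue_step set0 = 0%E.
Proof. by rewrite /lebesgue_step /pushforward preimage_set0 measure0. Qed.

Let lebesgue_step_ge0 A : (0 <= lebesgue_step A)%E.
Proof. by rewrite /lebesgue_step /pushforward measure_ge0. Qed.

Let lebesgue_step_sigma_additive : semi_sigma_additive lebesgue_step.
Proof.
move=> F mF tF mUF; rewrite /lebesgue_step /pushforward preimage_bigcup.
apply: measure_semi_sigma_additive.
- by move=> k; rewrite -[X in measurable X]setTI; exact: measurable_vcons.
- apply/trivIsetP => /= i j _ _ ij; rewrite -preimage_setI.
  by move/trivIsetP : tF => /(_ _ _ _ _ ij) ->//; rewrite preimage_set0.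
- by rewrite -preimage_bigcup -[X in measurable X]setTI; exact: measurable_vcons.
Qed.

HB.instance Definition _ := isMeasure.Build _ _ _ lebesgue_step
  lebesgue_step0 lebesgue_step_ge0 lebesgue_step_sigma_additive.

Let lebesgue_step_sigma_finite : sigma_finite setT lebesgue_step.
Proof.
have /sigma_finiteP[F [TF ndF Foo]] := sigma_finiteT (@lebesgue_measure R).
have /sigma_finiteP[G [TG ndG Goo]] := sigma_finiteT mu.
pose g (v : rvec R n.+1) : measurableTypeR R * rvec R n :=
  (thead v, [tuple of behead v]).
have gK : cancel vcons g.
  by move=> [x t]; rewrite /g /=; congr pair; apply: val_inj.
have vK : cancel g vcons by move=> v; rewrite /g /vcons /= [RHS]tuple_eta.
have mg : measurable_fun [set: rvec R n.+1] g.
  apply/measurable_fun_pairP; split => /=.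
    exact: measurable_tnth.
  exact: measurable_behead.
exists (fun k => g @^-1` (F k `*` G k)).
  rewrite -preimage_bigcup (_ : \bigcup_k _ = setT) ?preimage_setT//.
  apply/seteqP; split=> // -[x t] _.
  have [i _ Fx] : (\bigcup_i F i) x by rewrite -TF.
  have [j _ Gt] : (\bigcup_j G j) t by rewrite -TG.
  exists (maxn i j) => //; split=> /=.
    by move: x Fx; exact/subsetPset/ndF/leq_maxl.
  by move: t Gt; exact/subsetPset/ndG/leq_maxr.
move=> k; have [mF Fk] := Foo k; have [mG Gk] := Goo k; split.
  by rewrite -[X in measurable X]setTI; apply: mg => //; exact: measurableX.
rewrite /lebesgue_step /pushforward -comp_preimage.
rewrite (_ : g \o vcons = idfun); last by apply/funext => p /=; rewrite gK.
by rewrite preimage_id product_measure1E// lte_mul_pinfty// ge0_fin_numE.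
Qed.

HB.instance Definition _ := Measure_isSigmaFinite.Build _ _ _ lebesgue_step
  lebesgue_step_sigma_finite.

End lebesgue_measure_step.


Fixpoint lebesgue_measure_rvec (R : realType) (d : nat) :
    {sigma_finite_measure set (rvec R d) -> \bar R} :=
  match d with
  | 0 => \d_([tuple] : rvec R 0)
  | n.+1 => lebesgue_step (lebesgue_measure_rvec R n)
  end.

Lemma lebesgue_measure_rvec_box (R : realType) (d : nat)
    (A : 'I_d -> set (measurableTypeR R)) :
  (forall i, measurable (A i)) ->
  lebesgue_measure_rvec R d [set x | forall i, A i (tnth x i)] =
  (\prod_(i < d) lebesgue_measure (A i))%E.
Proof.
elim: d => [|d IH] in A * => mA.
  by rewrite big_ord0 /= diracE mem_set// => -[].
rewrite big_ord_recl /= /lebesgue_step /pushforward.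
set B := [set x : rvec R d | forall i, A (lift ord0 i) (tnth x i)].
have mB : measurable B.
  rewrite (_ : B = \bigcap_(i in [set: 'I_d])
      ((@tnth d (measurableTypeR R) ^~ i) @^-1` A (lift ord0 i))).
    apply: fin_bigcap_measurable => // i _.
    rewrite -[X in measurable X]setTI; exact: measurable_tnth.
  by apply/seteqP; split=> [x Bx i _|x Bx i]; [exact: Bx|exact: (Bx i I)].
rewrite (_ : _ @^-1` _ = A ord0 `*` B).
  by rewrite product_measure1E// /B (IH (fun i => A (lift ord0 i))).
apply/seteqP; split=> [[x t] /= H|[x t] [/= Ax Bt] i].
  by split=> [|i]; [exact: (H ord0)|have := H (lift ord0 i); rewrite tnthS].
have [j ->|->] := unliftP ord0 i; last exact: Ax.
by rewrite tnthS; exact: Bt.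
Qed.

Definition translate (R : realType) (d : nat) (t : rvec R d) (A : set (rvec R d)) :
    set (rvec R d) :=
  [set [tuple (tnth t i : R) + tnth x i | i < d] | x in A].

Definition dotp (R : realType) (d : nat) (x y : rvec R d) : R :=
  \sum_(i < d) (tnth x i : R) * tnth y i.

Definition expi (R : realType) (t : R) : R[i] := (cos t +i* sin t)%C.

Section complex_L2.
Context (disp : measure_display) (T : measurableType disp) (R : realType).
Variables (mu : {measure set T -> \bar R}) (D : set T).
Implicit Types f g : T -> R[i].

Definition cintegral f : R[i] :=
  ((\int[mu]_(x in D) complex.Re (f x))%R +i*
   (\int[mu]_(x in D) complex.Im (f x))%R)%C.

Definition sqr_norm2 f : \bar R :=
  (\int[mu]_(x in D) (ComplexField.Normc.normc (f x) ^+ 2)%:E)%E.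

(* On R^d the functions are Borel; every Lebesgue measurable function agrees
   almost everywhere with a Borel one, so the L^2 space is the usual one. *)
Definition in_L2 f : Prop :=
  [/\ measurable_fun D (fun x => complex.Re (f x)),
      measurable_fun D (fun x => complex.Im (f x)) &
      (sqr_norm2 f < +oo)%E].

Definition inner f g : R[i] := cintegral (fun x => f x * (g x)^*%C).

(* Basis in the Hilbert space sense: the finite linear combinations are dense
   in L^2(D). *)
Definition orthonormal_basis (J : choiceType) (I : set J) (e : J -> T -> R[i]) :
    Prop :=
  [/\ forall i, I i -> in_L2 (e i),
      forall i j, I i -> I j -> inner (e i) (e j) = (i == j)%:R &
      forall f, in_L2 f -> forall eps : R, 0 < eps ->
        exists (n : nat) (i : 'I_n -> J) (c : 'I_n -> R[i]),
          (forall k, I (i k)) /\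
          (sqr_norm2 (fun x => f x - \sum_(k < n) c k * e (i k) x)%R
             < eps%:E)%E].

End complex_L2.

Section spectral_and_tile.
Context (R : realType) (d : nat).
Let mu := lebesgue_measure_rvec R d.
Implicit Types (Omega Lambda Sigma : set (rvec R d)).

Definition normalized_exp Omega (xi x : rvec R d) : R[i] :=
  ((Num.sqrt (fine (mu Omega)))^-1)%:C%C * expi (2 * pi * dotp x xi).

Definition is_spectrum Omega Lambda : Prop :=
  orthonormal_basis mu Omega Lambda (normalized_exp Omega).

Definition spectral Omega : Prop := exists Lambda, is_spectrum Omega Lambda.

(* mu is only defined on Borel sets, hence negligibility, i.e. inclusion in a
   Borel null set, which is the same as being Lebesgue null. *)
Definition tiles_with Omega Sigma : Prop :=
  (forall s t, Sigma s -> Sigma t -> s <> t ->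
     mu.-negligible (translate s Omega `&` translate t Omega)) /\
  mu.-negligible (~` \bigcup_(t in Sigma) translate t Omega).

Definition tile Omega : Prop := exists Sigma, tiles_with Omega Sigma.

End spectral_and_tile.

Definition unit_cube (R : realType) (d : nat) : set (rvec R d) :=
  [set x | forall i, 0 <= (tnth x i : R) < 1].

Arguments unit_cube : clear implicits.

Definition int_rvec (R : realType) (d : nat) (s : d.-tuple int) : rvec R d :=
  [tuple ((tnth s i)%:~R : R) | i < d].

Definition cube_union (R : realType) (d k : nat) (s : 'I_k -> d.-tuple int) :
    set (rvec R d) :=
  \bigcup_(j in [set: 'I_k]) translate (int_rvec R (s j)) (unit_cube R d).
Arguments cube_union R {d k} s _.

(* Main.v *)
From HB Require Import structures.
Require Import Defs.
From mathcomp Require Import all_boot all_order all_algebra.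
From mathcomp Require Import complex.
From mathcomp Require Import all_classical all_reals all_analysis.
From mathcomp Require Import measurable_realfun.
From mathcomp Require finmap.
From mathcomp Require Import ring lra zify.

(** The construction goes back to Tao and Matolcsi. There is a 6 x 6 complex
    Hadamard matrix whose entries are cube roots of unity and whose matrix of
    exponents has rank 4 over the field with three elements. Its factorization
    gives six nodes and six frequencies in (Z/3)^4, hence in (Z/3)^d for d >= 4,
    such that the characters with these frequencies are orthogonal on the nodes
    (sum_node_freq). So the six nodes form a spectral set. They do not tile
    (Z/3)^d, because 6 does not divide 3^d.

    To leave (Z/3)^d, let T be the set of all nodes plus 3 m, with m in [0, n)^d,
    and let Omega be the union of the unit cubes with corners in T.

    Omega is spectral: the frequencies l / 3 + r / (3 n), with l one of the six
    frequencies and r in [0, n)^d, are orthogonal on T and as many as the points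
    of T (point_frequency_orth), and adding Z^d to them gives a spectrum of Omega
    (spectral_cube_union). Orthogonality is a computation. For completeness, the
    square matrix of the characters on T has orthogonal columns as well as
    orthogonal rows (dual_orth), which allows one to isolate each cell of Omega
    and reduces the problem to Z^d-periodic functions. Such functions are
    approximated by Fejer means, sampled at the points of a grid: these are
    trigonometric polynomials that converge boundedly at every point of
    continuity (fejer_op_cvg). This gives the indicators of orthants, then those
    of all measurable sets by a Dynkin system argument (approximable_indic), and
    finally all of L2 (L2_approximable).

    Omega is not a tile when n is large: consider the 3^d points x + y with y in
    {0, 1, 2}^d. A translate of Omega contains six of them when x is well inside
    of the cube [0, 3 n)^d that carries the translate, and none when x is far from
    this cube. As 3^d is odd, in a tiling almost every x is near the boundary of
    the cube of some tile (grid_parity). These boundary layers have measure of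
    order n^(d-1), whereas tiles have measure 6 n^d, so for large n they are too
    small to cover space (not_tile_fat_union). *)

Set Implicit Arguments.
Unset Strict Implicit.
Unset Printing Implicit Defensive.
Import Order.TTheory GRing.Theory Num.Theory.
Import numFieldNormedType.Exports.

Local Open Scope classical_set_scope.
Local Open Scope ring_scope.

(** * Translation invariance of Lebesgue measure *)

Section shift.
Context (R : realType).

Definition shift (d : nat) (t x : rvec R d) : rvec R d :=
  [tuple (tnth t i : R) + tnth x i | i < d].

Definition oppv (d : nat) (t : rvec R d) : rvec R d :=
  [tuple - (tnth t i : R) | i < d].

Lemma tnth_shift d (t x : rvec R d) i :
  tnth (shift t x) i = (tnth t i : R) + tnth x i.
Proof. by rewrite tnth_mktuple. Qed.

Lemma tnth_oppv d (t : rvec R d) i : tnth (oppv t) i = - (tnth t i : R).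
Proof. by rewrite tnth_mktuple. Qed.

Lemma shiftNK d (t : rvec R d) : cancel (shift t) (shift (oppv t)).
Proof.
by move=> x; apply: eq_from_tnth => i; rewrite !tnth_shift tnth_oppv addKr.
Qed.

Lemma shiftKN d (t : rvec R d) : cancel (shift (oppv t)) (shift t).
Proof.
by move=> x; apply: eq_from_tnth => i; rewrite !tnth_shift tnth_oppv addNKr.
Qed.

Lemma translateE d (t : rvec R d) A :
  translate t A = shift (oppv t) @^-1` A.
Proof.
apply/seteqP; split=> [_ [x Ax <-]|x Ax].
  by rewrite -[X in (_ @^-1` _) X]/(shift t x) /preimage/= shiftNK.
by exists (shift (oppv t) x) => //; exact: shiftKN.
Qed.

Lemma measurable_addl (a : R) :
  measurable_fun setT (fun x : measurableTypeR R => a + x : measurableTypeR R).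
Proof.
exact: (measurable_funD (measurable_cst _) (@measurable_id _ _ setT)).
Qed.

Lemma measurable_shift d (t : rvec R d) : measurable_fun setT (shift t).
Proof.
apply/measurable_fun_tnthP => i.
rewrite (_ : _ \o _ = (fun x : measurableTypeR R => (tnth t i : R) + x)
                        \o (fun x => tnth x i)); last first.
  by apply/funext => x /=; rewrite tnth_shift.
apply: measurableT_comp; last exact: measurable_tnth.
exact: measurable_addl.
Qed.

Lemma measurable_preshift d (t : rvec R d) A :
  measurable A -> measurable (shift t @^-1` A).
Proof.
by move=> mA; rewrite -[X in measurable X]setTI; exact: measurable_shift.
Qed.

Lemma measurable_translate d (t : rvec R d) A :
  measurable A -> measurable (translate t A).
Proof. by rewrite translateE; exact: measurable_preshift. Qed.

(** A translate of Lebesgue measure gives the same length to every interval. *)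
Lemma lebesgue_measure_preshift (a : R) (A : set (measurableTypeR R)) :
  measurable A -> lebesgue_measure ((fun x : R => a + x) @^-1` A) =
                  lebesgue_measure A.
Proof.
move=> mA.
pose f : {mfun (measurableTypeR R) >-> (measurableTypeR R)} :=
  HB.pack (fun x : measurableTypeR R => a + x : measurableTypeR R)
    (isMeasurableFun.Build _ _ _ _ _ (measurable_addl a)).
symmetry.
apply: (@lebesgue_measure_unique R (pushforward (@lebesgue_measure R) f)) => //.
move=> X /ocitvP [->|[[u v]/= uv ->]].
  by rewrite !measure0.
rewrite /pushforward.
rewrite (_ : _ @^-1` _ = `](u - a), (v - a)]%classic); last first.
  by apply/seteqP; split=> x /=; rewrite !in_itv/= => /andP[? ?];
    apply/andP; split; lra.
by rewrite !lebesgue_measure_itv/= !lte_fin ltrD2r uv -!EFinB opprB addrA subrK.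
Qed.

(** The measure in dimension d+1 is a product measure, which is determined by
    its values on measurable rectangles; these are preserved by a translation,
    on the first factor by the one-dimensional case and on the second one by
    induction. *)
Lemma rvec_measure_preshift d (t : rvec R d) A :
  measurable A ->
  lebesgue_measure_rvec R d (shift t @^-1` A) = lebesgue_measure_rvec R d A.
Proof.
elim: d t A => [|d IH] t A mA.
  rewrite (_ : shift t = id) ?preimage_id //.
  by apply/funext => x; apply: eq_from_tnth => -[].
rewrite /= /lebesgue_step /pushforward.
pose t0 : R := thead t; pose t' : rvec R d := [tuple of behead t].
pose g (p : measurableTypeR R * rvec R d) : measurableTypeR R * rvec R d :=
  (t0 + (p.1 : R), shift t' p.2).
have gE p : vcons (g p) = shift t (vcons p).
  apply: eq_from_tnth => i; rewrite tnth_shift.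
  have [j ->|->] := unliftP ord0 i; rewrite /= ?tnth0 //.
  rewrite !tnthS tnth_shift tnth_behead (_ : inord j.+1 = lift ord0 j) //.
  by apply: val_inj; rewrite /= inordK // ltnS.
have mg : measurable_fun setT g.
  apply/measurable_fun_pairP; split.
    apply: (measurableT_comp (measurable_addl t0)); exact: measurable_fst.
  apply: (measurableT_comp (measurable_shift t')); exact: measurable_snd.
pose f : {mfun _ >-> _} := HB.pack g (isMeasurableFun.Build _ _ _ _ _ mg).
have mC : measurable (@vcons R d @^-1` A).
  by rewrite -[X in measurable X]setTI; exact: measurable_vcons.
rewrite [RHS](@product_measure_unique _ _ _ _ _ _ _
  (pushforward (lebesgue_measure \x lebesgue_measure_rvec R d)%E f)) //.
  rewrite /pushforward; congr (_ _); apply/funext => p.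
  by rewrite /preimage/= -gE.
move=> B C mB mC'.
transitivity ((lebesgue_measure \x lebesgue_measure_rvec R d)%E
  (((fun x : R => t0 + x) @^-1` B) `*` (shift t' @^-1` C))) => //.
have mB' : measurable ((fun x : R => t0 + x) @^-1` B : set (measurableTypeR R)).
  by rewrite -[X in measurable X]setTI; exact: measurable_addl.
rewrite product_measure1E //; last exact: measurable_preshift.
by rewrite IH //; congr (_ * _)%E; exact: lebesgue_measure_preshift.
Qed.

Lemma measure_translate d (t : rvec R d) A : measurable A ->
  lebesgue_measure_rvec R d (translate t A) = lebesgue_measure_rvec R d A.
Proof. by move=> mA; rewrite translateE rvec_measure_preshift. Qed.

Lemma negligible_preshift d (t : rvec R d) A :
  (lebesgue_measure_rvec R d).-negligible A ->
  (lebesgue_measure_rvec R d).-negligible (shift t @^-1` A).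
Proof.
move=> [N [mN N0 AN]]; exists (shift t @^-1` N); split.
- exact: measurable_preshift.
- by rewrite rvec_measure_preshift.
- by move=> x; exact: AN.
Qed.

Lemma measurable_box d (A : 'I_d -> set (measurableTypeR R)) :
  (forall i, measurable (A i)) ->
  measurable [set x : rvec R d | forall i, A i (tnth x i)].
Proof.
move=> mA; rewrite (_ : [set x | _] = \bigcap_(i in [set: 'I_d])
      ((@tnth d (measurableTypeR R) ^~ i) @^-1` A i)).
  apply: fin_bigcap_measurable => // i _.
  rewrite -[X in measurable X]setTI; exact: measurable_tnth.
by apply/seteqP; split=> [x Bx i _|x Bx i]; [exact: Bx|exact: (Bx i I)].
Qed.

Definition hcube (d : nat) (a b : R) : set (rvec R d) :=
  [set x | forall i, a <= (tnth x i : R) < b].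
Arguments hcube : clear implicits.

Lemma hcubeE d a b : hcube d a b =
  [set x | forall i, [set` `[a, b[] (tnth x i)].
Proof. by apply/seteqP; split=> x /= H i; have := H i; rewrite in_itv. Qed.

Lemma measurable_hcube d a b : measurable (hcube d a b).
Proof. by rewrite hcubeE; apply: (measurable_box (fun=> measurable_itv _)). Qed.

Lemma measure_hcube d a b : a <= b ->
  lebesgue_measure_rvec R d (hcube d a b) = ((b - a) ^+ d)%:E.
Proof.
move=> ab; rewrite hcubeE.
rewrite (lebesgue_measure_rvec_box (A := fun=> [set` `[a, b[])); last first.
  by move=> i; exact: measurable_itv.
rewrite (eq_bigr (fun=> (b - a)%:E)); last first.
  move=> i _; rewrite lebesgue_measure_itv/= lte_fin.
  have [//|ba] := ltP a b; have -> : a = b by apply/eqP; rewrite eq_le ab.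
  by rewrite subrr.
by rewrite prodEFin prodr_const card_ord.
Qed.

End shift.
Arguments hcube {R} d a b.

(** * Packings, coverings and unions of integer cubes *)

Section seq_measure.
Context disp (T : measurableType disp) (R : realType).
Variable mu : {measure set T -> \bar R}.
Variables (I : choiceType).
Implicit Types (E : I -> set T) (r : seq I).

Lemma bigcup_seq_cons E i r :
  \bigcup_(j in [set` i :: r]) E j = E i `|` \bigcup_(j in [set` r]) E j.
Proof. by rewrite !bigcup_seq big_cons. Qed.

Lemma measurable_bigcup_seq E r : (forall i, i \in r -> measurable (E i)) ->
  measurable (\bigcup_(i in [set` r]) E i).
Proof.
move=> mE; rewrite bigcup_seq big_seq.
by elim/big_ind : _ => //; exact: measurableU.
Qed.

Lemma negligible_bigcup_seq E r : (forall i, i \in r -> mu.-negligible (E i)) ->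
  mu.-negligible (\bigcup_(i in [set` r]) E i).
Proof.
move=> nE; rewrite bigcup_seq big_seq; elim/big_ind : _ => //.
  exact: negligible_set0.
exact: negligibleU.
Qed.

Lemma measure_le_cover A N E r (b : R) : measurable A -> mu.-negligible N ->
  (forall i, i \in r -> measurable (E i)) ->
  (forall i, i \in r -> mu (E i) = b%:E) ->
  A `<=` N `|` \bigcup_(i in [set` r]) E i ->
  (mu A <= ((size r)%:R * b)%:E)%E.
Proof.
move=> mA [N' [mN' N'0 NN']] mE Eb AE.
have mU := measurable_bigcup_seq mE.
have : (mu A <= mu (N' `|` \bigcup_(i in [set` r]) E i))%E.
  apply: le_measure; rewrite ?inE //; first exact: measurableU.
  by apply: (subset_trans AE); exact: setSU.
rewrite setUC measureU0 //; move/le_trans; apply.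
elim: r mE Eb {AE mU} => [|i r IH] mE Eb.
  by rewrite bigcup_seq big_nil measure0 mul0r.
have mE' j : j \in r -> measurable (E j).
  by move=> jr; apply: mE; rewrite inE jr orbT.
have Eb' j : j \in r -> mu (E j) = b%:E.
  by move=> jr; apply: Eb; rewrite inE jr orbT.
have mEi : measurable (E i) by apply: mE; rewrite inE eqxx.
have le2 : (mu (E i `|` \bigcup_(j in [set` r]) E j) <=
            mu (E i) + mu (\bigcup_(j in [set` r]) E j))%E.
  by apply: measureU2 => //; exact: measurable_bigcup_seq.
rewrite bigcup_seq_cons; apply: le_trans le2 _.
rewrite Eb ?inE ?eqxx // [size _]/= -add1n natrD mulrDl mul1r EFinD.
by apply: leeD => //; exact: IH.
Qed.

Lemma measure_ae_disjoint E r (v : R) : uniq r ->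
  (forall i, i \in r -> measurable (E i)) ->
  (forall i, i \in r -> mu (E i) = v%:E) ->
  (forall i j, i \in r -> j \in r -> i <> j -> mu.-negligible (E i `&` E j)) ->
  mu (\bigcup_(i in [set` r]) E i) = ((size r)%:R * v)%:E.
Proof.
elim: r => [|i r IH] /=.
  by rewrite bigcup_seq big_nil measure0 mul0r.
move=> /andP[ir ur] mE Ev disj.
have mE' j : j \in r -> measurable (E j).
  by move=> jr; apply: mE; rewrite inE jr orbT.
have Ev' j : j \in r -> mu (E j) = v%:E.
  by move=> jr; apply: Ev; rewrite inE jr orbT.
have mEi : measurable (E i) by apply: mE; rewrite inE eqxx.
have Evi : mu (E i) = v%:E by apply: Ev; rewrite inE eqxx.
have mU := measurable_bigcup_seq mE'.
have I0 : mu (E i `&` \bigcup_(j in [set` r]) E j) = 0%E.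
  apply: measure_negligible; first exact: measurableI.
  rewrite setI_bigcupr; apply: negligible_bigcup_seq => j jr.
  apply: disj; rewrite ?inE ?eqxx ?jr ?orbT // => ij.
  by move: ir; rewrite ij jr.
have UE : (mu (E i `|` \bigcup_(j in [set` r]) E j) =
  mu (E i) + mu (\bigcup_(j in [set` r]) E j) -
  mu (E i `&` \bigcup_(j in [set` r]) E j))%E.
  by apply: measureUfinl => //; rewrite Evi ltry.
rewrite bigcup_seq_cons UE I0 sube0 Evi IH //.
  by rewrite -[(size r).+1]add1n natrD mulrDl mul1r.
by move=> j l jr lr; apply: disj; rewrite inE ?jr ?lr orbT.
Qed.

Lemma measure_packing E r W (v : R) : uniq r ->
  (forall i, i \in r -> measurable (E i)) ->
  (forall i, i \in r -> mu (E i) = v%:E) ->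
  (forall i j, i \in r -> j \in r -> i <> j -> mu.-negligible (E i `&` E j)) ->
  measurable W -> (forall i, i \in r -> E i `<=` W) ->
  (((size r)%:R * v)%:E <= mu W)%E.
Proof.
move=> ur mE Ev disj mW EW; rewrite -(measure_ae_disjoint ur mE Ev disj).
apply: le_measure; rewrite ?inE //; first exact: measurable_bigcup_seq.
by move=> x [i ir Eix]; exact: EW Eix.
Qed.

End seq_measure.

Section cubes.
Context (R : realType) (d : nat).

Definition floorv (x : rvec R d) : d.-tuple int :=
  [tuple Num.floor (tnth x i : R) | i < d].

Lemma translate_cubeE (v : d.-tuple int) :
  translate (int_rvec R v) (unit_cube R d) = [set x | floorv x = v].
Proof.
rewrite translateE; apply/seteqP; split=> x /=.
  move=> H; apply: eq_from_tnth => i; rewrite tnth_mktuple.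
  have := H i; rewrite tnth_shift tnth_oppv tnth_mktuple => xi.
  by apply/eqP; rewrite floor_eq intrD; lra.
move=> H i; rewrite tnth_shift tnth_oppv tnth_mktuple.
have : Num.floor (tnth x i : R) == tnth v i by rewrite -H tnth_mktuple.
by rewrite floor_eq intrD; lra.
Qed.

Lemma translate_cube_box (v : d.-tuple int) :
  translate (int_rvec R v) (unit_cube R d) =
  [set x | forall i, [set` `[(tnth v i)%:~R : R, (tnth v i)%:~R + 1[] (tnth x i)].
Proof.
rewrite translate_cubeE; apply/seteqP; split=> x /=.
  move=> H i; rewrite in_itv/=.
  have : Num.floor (tnth x i : R) == tnth v i by rewrite -H tnth_mktuple.
  by rewrite floor_eq intrD.
move=> H; apply: eq_from_tnth => i; rewrite tnth_mktuple; apply/eqP.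
by rewrite floor_eq intrD; have := H i; rewrite in_itv.
Qed.

Lemma measurable_translate_cube (v : d.-tuple int) :
  measurable (translate (int_rvec R v) (unit_cube R d)).
Proof.
rewrite translate_cube_box.
apply: (measurable_box
  (A := fun i => [set` `[(tnth v i)%:~R : R, (tnth v i)%:~R + 1[])) => i.
exact: measurable_itv.
Qed.

Lemma unit_cubeE : unit_cube R d = hcube d 0 1.
Proof. by []. Qed.

Lemma measure_translate_cube (v : d.-tuple int) :
  lebesgue_measure_rvec R d (translate (int_rvec R v) (unit_cube R d)) = 1%E.
Proof.
rewrite measure_translate; last exact: measurable_hcube.
by rewrite unit_cubeE measure_hcube // subr0 expr1n.
Qed.

Variables (k : nat) (s : 'I_k -> d.-tuple int).

Lemma cube_unionE : cube_union R s = [set x | exists j, s j = floorv x].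
Proof.
apply/seteqP; split=> x /=.
  by move=> [j _]; rewrite translate_cubeE/= => xj; exists j.
by move=> [j sj]; exists j => //; rewrite translate_cubeE.
Qed.

Lemma cube_union_seq : cube_union R s =
  \bigcup_(j in [set` enum 'I_k]) translate (int_rvec R (s j)) (unit_cube R d).
Proof.
by apply: eq_bigcupl; split=> j //= _; rewrite mem_enum.
Qed.

Lemma measurable_cube_union : measurable (cube_union R s).
Proof.
rewrite cube_union_seq; apply: measurable_bigcup_seq => j _.
exact: measurable_translate_cube.
Qed.

Lemma measure_cube_union : injective s ->
  lebesgue_measure_rvec R d (cube_union R s) = k%:R%:E.
Proof.
move=> inj; rewrite cube_union_seq (@measure_ae_disjoint _ _ _ _ _ _ _ 1).
- by rewrite size_enum_ord mulr1.
- exact: enum_uniq.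
- by move=> j _; exact: measurable_translate_cube.
- by move=> j _; exact: measure_translate_cube.
move=> i j _ _ ij; rewrite !translate_cubeE.
rewrite (_ : _ `&` _ = set0); first exact: negligible_set0.
apply/seteqP; split=> x //= [-> /inj ]; exact: ij.
Qed.

End cubes.

(** * A parity obstruction to tiling *)

Section residue_count.
Variables (d n : nat) (A : {set {ffun 'I_d -> 'Z_3}}).

Definition residue (v : d.-tuple int) : {ffun 'I_d -> 'Z_3} :=
  [ffun i => (tnth v i)%:~R].

(** The points of the cube [0, 3n)^d whose class modulo 3 lies in A. It
    consists of n ^ d translates of a copy of A, so that a tiling by it looks,
    away from the boundaries of the tiles, like a tiling modulo 3 by A. *)
Definition fat_set (v : d.-tuple int) : bool :=
  [forall i, 0 <= tnth v i < (3 * n)%:Z] && (residue v \in A).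

Definition add_offset (w : d.-tuple int) (y : {ffun 'I_d -> 'Z_3}) : d.-tuple int :=
  [tuple tnth w i + (y i : nat)%:Z | i < d].

Lemma residue_add_offset w y : residue (add_offset w y) = y + residue w.
Proof.
apply/ffunP => i; rewrite !ffunE tnth_mktuple intrD addrC; congr (_ + _).
by rewrite -pmulrn natr_Zp.
Qed.

(** The 3^d points of the window run once through the residues modulo 3. *)
Lemma window_count_inner (w : d.-tuple int) :
  (forall i, 0 <= tnth w i <= (3 * n)%:Z - 3) ->
  #|[pred y | fat_set (add_offset w y)]| = #|A|.
Proof.
move=> win.
pose f (y : {ffun 'I_d -> 'Z_3}) := y + residue w.
rewrite (@eq_card _ _ (mem (f @^-1: A))).
  apply: on_card_preimset.
  by exists (fun y => y - residue w) => y _; rewrite /f ?addrK ?subrK.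
move=> y; rewrite !inE /fat_set residue_add_offset andb_idl //= => _.
apply/forallP => i; rewrite tnth_mktuple.
have := win i; have : (y i < 3)%N by apply: ltn_ord.
by move: (nat_of_ord (y i)) => m; lia.
Qed.

Lemma window_count_outer (w : d.-tuple int) i :
  (tnth w i < -2) || ((3 * n)%:Z <= tnth w i) ->
  #|[pred y | fat_set (add_offset w y)]| = 0.
Proof.
move=> wi; apply: eq_card0 => y; rewrite !inE /fat_set.
apply/negP => /andP[/forallP /(_ i)]; rewrite tnth_mktuple.
have : (y i < 3)%N by apply: ltn_ord.
by move: (nat_of_ord (y i)) wi => m; lia.
Qed.

End residue_count.

Section nontile.
Context (R : realType) (d n : nat) (A : {set {ffun 'I_d -> 'Z_3}}).
Variables (k : nat) (s : 'I_k -> d.-tuple int).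
Hypothesis n0 : (0 < n)%N.
Hypothesis s_inj : injective s.
Hypothesis sE : forall v, (exists j, s j = v) <-> fat_set n A v.
Hypothesis A_even : ~~ odd #|A|.
Let mu := lebesgue_measure_rvec R d.
Let Omega := cube_union R s.
(* If x - t lies outside of the collar, then the translate of Omega by t has
   either #|A| points or none in the 3 x ... x 3 window at x. *)
Let collar : set (rvec R d) :=
  hcube d (-2) (3 * n)%:R `\` hcube d 0 ((3 * n)%:R - 2).

Definition grid_vec (y : {ffun 'I_d -> 'Z_3}) : rvec R d :=
  [tuple (y i : nat)%:R | i < d].

Lemma floorv_grid (t x : rvec R d) y :
  floorv (shift (oppv t) (shift (grid_vec y) x)) =
  add_offset (floorv (shift (oppv t) x)) y.
Proof.
apply: eq_from_tnth => i; rewrite !tnth_mktuple.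
set f := Num.floor (_ + tnth x i).
apply/eqP; rewrite floor_eq.
have : Num.floor (- tnth t i + tnth x i : R) == f by [].
by rewrite floor_eq !intrD -pmulrn; lra.
Qed.

Lemma grid_in_translate (t x : rvec R d) y :
  translate t Omega (shift (grid_vec y) x) <->
  fat_set n A (add_offset (floorv (shift (oppv t) x)) y).
Proof. by rewrite translateE /Omega cube_unionE /= floorv_grid; exact: sE. Qed.

Lemma window_count_even (x : rvec R d) : ~ collar x ->
  ~~ odd #|[pred y | fat_set n A (add_offset (floorv x) y)]|.
Proof.
move=> xB.
have fl i : ((tnth (floorv x) i)%:~R <= (tnth x i : R) < (tnth (floorv x) i)%:~R + 1).
  have : Num.floor (tnth x i : R) == tnth (floorv x) i by rewrite tnth_mktuple.
  by rewrite floor_eq intrD.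
case: (pselect (forall i, -2 <= (tnth x i : R) < (3 * n)%:R)) => [xout|].
  have xin : hcube d 0 ((3 * n)%:R - 2) x by apply: contrapT => xin; apply: xB.
  rewrite window_count_inner // => i.
  have := xin i; have := fl i; move: (tnth x i : R) (tnth (floorv x) i) => a m.
  move=> /andP[ma am] /andP[a0 an].
  have : (-1)%:~R < m%:~R :> R by rewrite mulrNz; lra.
  have : m%:~R < ((3 * n)%:Z - 2)%:~R :> R by rewrite intrD -pmulrn mulrNz; lra.
  by rewrite !ltr_int; lia.
move=> /existsNP[i xi]; rewrite (@window_count_outer _ _ _ _ i) //.
have := fl i; move: xi; move: (tnth x i : R) (tnth (floorv x) i) => a m.
move=> xi /andP[ma am]; apply/negPn; rewrite negb_or -ltNge -leNgt.
apply/negP => /andP[m2 m3].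
apply: xi; apply/andP; split.
  by apply: le_trans ma; rewrite (_ : -2 = (-2)%:~R) ?ler_int // mulrNz.
apply: (lt_le_trans am).
by rewrite -(intrD _ m 1) pmulrn ler_int; lia.
Qed.

(** The window at x has 3^d points, an odd number. If each of them lies in
    exactly one translate of Omega, then some translate has an odd number of
    points in the window, and it can only do so when x is in its collar. *)
Lemma grid_parity (r : seq (rvec R d)) (x : rvec R d) : uniq r ->
  (forall y, exists2 t, t \in r & translate t Omega (shift (grid_vec y) x)) ->
  (forall y t u, t \in r -> u \in r ->
     translate t Omega (shift (grid_vec y) x) ->
     translate u Omega (shift (grid_vec y) x) -> t = u) ->
  exists2 t, t \in r & translate t collar x.
Proof.
move=> ur cov disj; apply: contrapT => nex.
pose P (t : rvec R d) y := fat_set n A (add_offset (floorv (shift (oppv t) x)) y).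
have E1 y : (\sum_(t <- r) (P t y : nat) = 1)%N.
  have [t tr tO] := cov y.
  rewrite (eq_bigr (fun t => if P t y then 1 else 0)%N); last first.
    by move=> u _; case: (P u y).
  rewrite -big_mkcond/= sum1_count.
  rewrite (@eq_in_count _ _ (pred1 t)) ?count_uniq_mem ?tr // => u ur' /=.
  apply/idP/eqP => [/grid_in_translate uO|->]; last exact/grid_in_translate.
  exact: disj uO tO.
have : odd (\sum_(y : {ffun 'I_d -> 'Z_3}) \sum_(t <- r) (P t y : nat))%N.
  rewrite (eq_bigr (fun=> 1%N)) // sum1_card card_ffun card_ord card_ord.
  by rewrite oddX orbT.
apply/negP; rewrite exchange_big/= big_seq.
elim/big_ind : _ => // [a b|t tr]; first by rewrite oddD => /negbTE-> /negbTE->.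
rewrite (eq_bigr (fun y => if P t y then 1 else 0)%N); last first.
  by move=> y _; case: (P t y).
rewrite -big_mkcond/= sum1_card; apply: window_count_even => tB.
by apply: nex; exists t => //; rewrite translateE.
Qed.

Lemma fat_union_bound (x : rvec R d) i : Omega x ->
  0 <= (tnth x i : R) < (3 * n)%:R.
Proof.
rewrite /Omega cube_unionE /= => /sE /andP[/forallP /(_ i) + _].
have : Num.floor (tnth x i : R) == tnth (floorv x) i by rewrite tnth_mktuple.
rewrite floor_eq; move: (tnth (floorv x) i) => m /andP[mx xm] /andP[m0 mn].
apply/andP; split; first by apply: le_trans mx; rewrite ler0z.
by apply: (lt_le_trans xm); rewrite pmulrn ler_int; lia.
Qed.

Lemma measurable_collar : measurable collar.
Proof. by apply: measurableD; exact: measurable_hcube. Qed.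

Lemma measure_collar :
  mu collar = (((3 * n)%:R + 2) ^+ d - ((3 * n)%:R - 2) ^+ d)%:E.
Proof.
have n1 : 1 <= n%:R :> R by rewrite ler1n.
have sub : hcube d (0 : R) ((3 * n)%:R - 2) `<=` hcube d (-2) (3 * n)%:R.
  by move=> x xin i; have := xin i; rewrite natrM; lra.
have e1 : mu (hcube d (-2) (3 * n)%:R) = (((3 * n)%:R + 2) ^+ d)%:E.
  by rewrite /mu measure_hcube ?opprK // natrM; lra.
have e2 : mu (hcube d 0 ((3 * n)%:R - 2)) = (((3 * n)%:R - 2) ^+ d)%:E.
  by rewrite /mu measure_hcube ?subr0 // natrM; lra.
have lt1 : (mu (hcube d (-2) (3 * n)%:R) < +oo)%E by rewrite e1 ltry.
have mD : (mu collar = mu (hcube d (-2) (3 * n)%:R) -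
    mu (hcube d (-2) (3 * n)%:R `&` hcube d 0 ((3 * n)%:R - 2)))%E.
  by apply: measureD; [exact: measurable_hcube|exact: measurable_hcube|exact: lt1].
by rewrite mD setIidr // e1 e2.
Qed.

(** In a tiling almost every point lies in the collar of some tile, by
    grid_parity, so the collars cover space although they have much smaller
    measure than the tiles: counting the p tiles located near a large cube of
    side M gives M ^ d <= p * (measure of the collar) by covering and
    p * k <= (2 M) ^ d by packing. *)
Lemma not_tile_fat_union :
  2 ^+ d * (((3 * n)%:R + 2) ^+ d - ((3 * n)%:R - 2) ^+ d) < k%:R :> R ->
  ~ tile Omega.
Proof.
move=> big [Sigma [disj cov]].
have n1 : 1 <= n%:R :> R by rewrite ler1n.
(* L bounds the diameter of a tile and its collar; with M = 3 L the tiles that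
   matter for the cube of side M lie in a cube of side M + 3 L = 2 M. *)
pose L : R := (3 * n)%:R + 2; pose M := 3 * L.
have L5 : 5 <= L by rewrite /L natrM; lra.
pose S' := Sigma `&` hcube d (- L) (M + L).
have mO : measurable Omega := measurable_cube_union s.
have muT t : mu (translate t Omega) = k%:R%:E.
  by rewrite /mu measure_translate // measure_cube_union.
have pack r : uniq r -> (forall t, t \in r -> S' t) ->
    (size r)%:R * k%:R <= (M + 3 * L) ^+ d.
  move=> ur rS; rewrite -lee_fin.
  rewrite (_ : M + 3 * L = M + 2 * L - - L); last by ring.
  rewrite -measure_hcube; last by rewrite /M; lra.
  apply: (@measure_packing _ _ _ _ _ (fun t => translate t Omega)) => //.
  - by move=> t _; exact: measurable_translate.
  - by move=> t _; exact: muT.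
  - by move=> t u /rS[tS _] /rS[uS _]; exact: disj.
  - exact: measurable_hcube.
  - move=> t /rS[_ tW] x; rewrite translateE => xO i.
    have := fat_union_bound i xO; have := tW i.
    by rewrite tnth_shift tnth_oppv /M /L; lra.
have k0 : 0 < k%:R :> R.
  apply: le_lt_trans big; rewrite mulr_ge0 ?exprn_ge0 // subr_ge0.
  by apply: lerXn2r; rewrite ?nnegrE natrM; lra.
have finS : finite_set S'.
  apply: contrapT => infS.
  pose bound := (Num.truncn ((M + 3 * L) ^+ d / k%:R)).+1.
  have [F FS Fn] := @infinite_set_fset _ S' bound infS.
  have := pack (finmap.enum_fset F) (finmap.fset_uniq F) (fun t tF => FS t tF).
  rewrite -ler_pdivlMr //; apply/negP; rewrite -ltNge.
  apply: (lt_le_trans (truncnS_gt _)).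
  by rewrite ler_nat.
have [r0 S'E] := (finite_seqP S').1 finS.
pose r := undup r0.
have rE t : (t \in r) <-> S' t by rewrite mem_undup S'E.
have ur : uniq r := undup_uniq _.
pose N0 := ~` (\bigcup_(t in Sigma) translate t Omega) `|`
  \bigcup_(t in [set` r]) \bigcup_(u in [set` r])
    (if t == u then set0 else translate t Omega `&` translate u Omega).
have nN0 : mu.-negligible N0.
  apply: negligibleU => //.
  apply: negligible_bigcup_seq => t /rE[tS _].
  apply: negligible_bigcup_seq => u /rE[uS _].
  by case: eqP => [_|tu]; [exact: negligible_set0|exact: disj].
pose N := \bigcup_(y in [set` enum {ffun 'I_d -> 'Z_3}])
  (shift (grid_vec y) @^-1` N0).
have nN : mu.-negligible N.
  by apply: negligible_bigcup_seq => y _; exact: negligible_preshift.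
have cover : hcube d 0 M `<=`
    N `|` \bigcup_(t in [set` r]) translate t collar.
  move=> x xM; have [xN|xN] := pselect (N x); [by left|right].
  have xN0 y : ~ N0 (shift (grid_vec y) x).
    by move=> h; apply: xN; exists y => //=; rewrite mem_enum.
  have [|y t u tr uR xt xu|t tr xt] := @grid_parity r x ur; last by exists t.
    move=> y; have /not_orP[/contrapT[t tS tO] _] := xN0 y.
    exists t => //; apply/rE; split=> // i.
    move: tO; rewrite translateE => /(fat_union_bound i).
    have := xM i; have : (y i < 3)%N by apply: ltn_ord.
    rewrite !tnth_shift tnth_oppv tnth_mktuple -(ltr_nat R) /M /L.
    have : 0 <= (y i : nat)%:R :> R by [].
    by move: ((y i : nat)%:R) => yi; lra.
  apply: contrapT => tu; apply: (xN0 y); right; exists t => //; exists u => //.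
  by case: eqP.
pose b : R := ((3 * n)%:R + 2) ^+ d - ((3 * n)%:R - 2) ^+ d.
have muC t : mu (translate t collar) = b%:E.
  by rewrite /mu measure_translate ?measure_collar //; exact: measurable_collar.
have muH : mu (hcube d 0 M) = (M ^+ d)%:E.
  by rewrite /mu measure_hcube ?subr0 // /M; lra.
have cv : (mu (hcube d 0 M) <= ((size r)%:R * b)%:E)%E.
  apply: measure_le_cover nN _ _ cover; first exact: measurable_hcube.
    by move=> t _; apply: measurable_translate; exact: measurable_collar.
  by move=> t _; exact: muC.
have {}cv : M ^+ d <= (size r)%:R * b by rewrite -lee_fin -muH.
have := pack r ur (fun t tr => (rE t).1 tr).
rewrite (_ : M + 3 * L = 2 * M); last by rewrite /M; ring.
rewrite [(2 * M) ^+ d]exprMn.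
move=> pk.
have Md : 0 < M ^+ d by rewrite exprn_gt0 // /M; lra.
have : M ^+ d * k%:R <= M ^+ d * (2 ^+ d * b).
  have b0 : 0 <= b.
    by rewrite /b subr_ge0; apply: lerXn2r; rewrite ?nnegrE natrM; lra.
  apply: (le_trans (ler_wpM2r (ltW k0) cv)).
  rewrite mulrAC (_ : M ^+ d * (2 ^+ d * b) = 2 ^+ d * M ^+ d * b); last by ring.
  exact: ler_wpM2r.
by rewrite ler_pM2l // leNgt big.
Qed.

End nontile.

(** * Characters of the circle *)

Import ComplexField.Normc.
Local Open Scope complex_scope.

Section expi.
Context (R : realType).
Local Notation C := R[i].

(** The character exp (2 pi i x), normalized so that its period is 1. *)
Definition e1 (x : R) : C := expi (2 * pi * x).

Lemma e1D x y : e1 (x + y) = e1 x * e1 y.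
Proof.
rewrite /e1 /expi mulrDr cosD sinD; simpc; congr (_ +i* _).
by rewrite addrC (mulrC (sin _)) .
Qed.

Lemma e10 : e1 0 = 1.
Proof. by rewrite /e1 /expi mulr0 cos0 sin0. Qed.

Lemma e1N x : e1 (- x) = (e1 x)^*.
Proof. by rewrite /e1 /expi mulrN cosN sinN. Qed.

Lemma normc_e1 x : normc (e1 x) = 1.
Proof. by rewrite /e1 /expi /normc cos2Dsin2 sqrtr1. Qed.

Lemma e1_half : e1 (1 / 2) = -1.
Proof.
rewrite /e1 /expi (_ : 2 * pi * (1 / 2) = pi); last by field.
by rewrite cospi sinpi; apply/eqP; rewrite eq_complex /= oppr0 !eqxx.
Qed.

Lemma e1_1 : e1 1 = 1.
Proof.
by rewrite (_ : 1 = 1 / 2 + 1 / 2 :> R) ?e1D ?e1_half ?mulrNN ?mulr1 //; lra.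
Qed.

Lemma e1_nat (m : nat) : e1 m%:R = 1.
Proof. by elim: m => [|m IH]; rewrite ?e10 // -addn1 natrD e1D IH e1_1 mulr1. Qed.

Lemma e1_int (m : int) : e1 m%:~R = 1.
Proof.
case: m => m; first by rewrite -pmulrn e1_nat.
by rewrite NegzE mulrNz e1N -pmulrn e1_nat conjc1.
Qed.

Lemma e1_sum (I : Type) (r : seq I) (P : pred I) (f : I -> R) :
  e1 (\sum_(i <- r | P i) f i) = \prod_(i <- r | P i) e1 (f i).
Proof. exact: (big_morph e1 e1D e10). Qed.

Lemma e1_muln x (n : nat) : e1 (x * n%:R) = e1 x ^+ n.
Proof.
elim: n => [|n IH]; first by rewrite mulr0 e10.
by rewrite -addn1 natrD mulrDr mulr1 e1D IH exprD expr1.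
Qed.

Lemma mul_conjc_normc (z : C) : z * z^* = (normc z ^+ 2)%:C.
Proof.
case: z => a b; rewrite /normc sqr_sqrtr ?addr_ge0 ?sqr_ge0 //; simpc.
by congr (_ +i* _); ring.
Qed.

Lemma normc_ge0 (z : C) : 0 <= normc z.
Proof. by case: z => a b; rewrite sqrtr_ge0. Qed.

Lemma normc_real (a : R) : normc a%:C = `|a|.
Proof. by rewrite /normc /= expr0n /= addr0 sqrtr_sqr. Qed.

Lemma normc_sqr (z : C) : normc z ^+ 2 = complex.Re z ^+ 2 + complex.Im z ^+ 2.
Proof. by case: z => a b; rewrite /normc sqr_sqrtr ?addr_ge0 ?sqr_ge0. Qed.

Lemma normc_sum (I : Type) (r : seq I) (P : pred I) (f : I -> C) :
  normc (\sum_(i <- r | P i) f i) <= \sum_(i <- r | P i) normc (f i).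
Proof.
elim/big_rec2 : _ => [|i y z _ yz]; first by rewrite normc0.
by apply: (le_trans (le_normcD _ _)); rewrite lerD2l.
Qed.

Lemma e1B1_sqr x : normc (e1 x - 1) ^+ 2 = 4 * sin (pi * x) ^+ 2.
Proof.
rewrite normc_sqr /e1 /expi /=.
have -> : 2 * pi * x = (pi * x) *+ 2 by rewrite -mulr_natr; ring.
rewrite cos_mulr2n sin_mulr2n.
have := cos2Dsin2 (pi * x); move: (cos _) (sin _) => c s' h.
have c2 : c ^+ 2 = 1 - s' ^+ 2 by rewrite -h addrK.
transitivity ((c ^+ 2 *+ 2 - 2) ^+ 2 + 4 * c ^+ 2 * s' ^+ 2); first by ring.
by rewrite c2; ring.
Qed.

Lemma e1_neq1 x : 0 < x < 1 -> e1 x != 1.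
Proof.
move=> /andP[x0 x1]; rewrite -subr_eq0; apply/eqP => e0.
have := e1B1_sqr x; rewrite e0 normc0 expr0n /= => /esym/eqP.
rewrite mulf_eq0 pnatr_eq0 /= sqrf_eq0; apply/negP.
rewrite gt_eqF // sin_gt0_pi // mulr_gt0 ?pi_gt0 //=.
by rewrite gtr_pMr ?pi_gt0.
Qed.

Lemma e1_frac_eq1 (n : nat) (a : int) : (`|a| < n)%N ->
  (e1 (a%:~R / n%:R) == 1) = (a == 0).
Proof.
move=> an; have n1 : (0 < n)%N by lia.
have n0 : 0 < n%:R :> R by rewrite ltr0n.
have pos (m : nat) : (0 < m < n)%N -> e1 (m%:R / n%:R) != 1.
  move=> /andP[m0 mn]; apply: e1_neq1; rewrite divr_gt0 ?ltr0n //=.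
  by rewrite ltr_pdivrMr // mul1r ltr_nat.
have [->|a0] := eqVneq a 0; first by rewrite mul0r e10 eqxx.
apply/negbTE; case: a an a0 => m mn m0.
  by rewrite -pmulrn; apply: pos; move: m0 mn; lia.
rewrite NegzE mulrNz mulNr e1N -pmulrn.
apply/eqP => /(congr1 conjc); rewrite conjcK conjc1; apply/eqP/pos.
by move: mn; lia.
Qed.

(** A geometric sum whose ratio is an n-th root of unity, different from 1
    unless a = 0. *)
Lemma sum_e1_frac (n : nat) (a : int) : (`|a| < n)%N ->
  \sum_(j < n) e1 (a%:~R / n%:R * (j : nat)%:R) = (n * (a == 0))%:R.
Proof.
move=> an; have n0 : n%:R != 0 :> R by rewrite pnatr_eq0; lia.
have [->|a0] := eqVneq a 0.
  rewrite (eq_bigr (fun=> 1)); last by move=> j _; rewrite mul0r mul0r e10.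
  by rewrite sumr_const card_ord muln1.
rewrite muln0; set z := e1 (a%:~R / n%:R).
have z1 : z - 1 != 0 by rewrite subr_eq0 e1_frac_eq1.
apply/(mulfI z1); rewrite mulr0.
rewrite (eq_bigr (fun j : 'I_n => z ^+ j)); last by move=> j _; rewrite e1_muln.
by rewrite -subrX1 -e1_muln mulfVK // e1_int subrr.
Qed.

End expi.

(** * Fejer operators on the torus *)

Section fejer1.
Context (R : realType).
Local Notation C := R[i].

(** The Fejer kernel of order m divided by m: as a function of y it is a
    nonnegative trigonometric polynomial concentrated near the integers. *)
Definition fejer (m : nat) (y : R) : R :=
  normc (\sum_(k < m) e1 (y * (k : nat)%:R)) ^+ 2 / m%:R ^+ 2.

Lemma fejer_ge0 m y : 0 <= fejer m y.
Proof. by rewrite divr_ge0 ?sqr_ge0. Qed.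

Lemma fejerE m y : (fejer m y)%:C =
  (\sum_(k < m) e1 (y * (k : nat)%:R)) * (\sum_(k < m) e1 (- y * (k : nat)%:R))
    * (m%:R ^- 2)%:C.
Proof.
rewrite /fejer rmorphM /= -mul_conjc_normc rmorph_sum; congr (_ * _ * _).
by apply: eq_bigr => k _; rewrite mulNr e1N.
Qed.

(** Expanding the square gives frequencies k - l with |k - l| < m; summing over
    j < m kills all of them except the constant term. *)
Lemma sum_fejer m x : (0 < m)%N ->
  \sum_(j < m) fejer m (x - (j : nat)%:R / m%:R) = 1.
Proof.
move=> m0; have mn0 : m%:R != 0 :> C by rewrite pnatr_eq0; lia.
have mr0 : m%:R != 0 :> R by rewrite pnatr_eq0; lia.
apply: complexI; rewrite rmorph_sum /=.
under eq_bigr => j _ do rewrite fejerE big_distrlr /= mulr_suml.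
rewrite exchange_big /=.
transitivity (\sum_(k < m) (m%:R^-1 : C)); last first.
  by rewrite sumr_const card_ord -[_ *+ m]mulr_natr mulVf.
apply: eq_bigr => k _.
under eq_bigr => j _ do rewrite mulr_suml.
rewrite exchange_big /=.
rewrite (eq_bigr (fun l : 'I_m => e1 (x * ((k : nat)%:R - (l : nat)%:R)) *
    (m * (((l : nat)%:Z - (k : nat)%:Z) == 0))%:R * (m%:R ^- 2)%:C)); last first.
  move=> l _; rewrite -mulr_suml -(sum_e1_frac R); last first.
    by have := ltn_ord k; have := ltn_ord l; lia.
  rewrite mulr_sumr; congr (_ * _); apply: eq_bigr => j _.
  rewrite -!e1D intrB -!pmulrn; congr (e1 _).
  by field.
rewrite (bigD1 k) //= big1 ?addr0.
  rewrite subrr mulr0 e10 mul1r subrr eqxx muln1 rmorphV ?unitfE ?expf_neq0 //=.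
  by rewrite rmorphXn /= rmorph_nat expr2 invfM mulrA mulfV // mul1r.
move=> l lk; rewrite subr_eq0 eqz_nat.
by rewrite -val_eqE /= in lk; rewrite (negbTE lk) muln0 mulr0 mul0r.
Qed.

(** By the geometric sum, multiplying the kernel by e1 y - 1 leaves only
    e1 (m y) - 1, of modulus at most 2. *)
Lemma fejer_second_moment_le m y :
  fejer m y * normc (e1 y - 1) ^+ 2 <= 4 / m%:R ^+ 2.
Proof.
rewrite /fejer mulrAC ler_wpM2r ?invr_ge0 ?sqr_ge0 //.
rewrite -exprMn -normcM mulrC.
rewrite (eq_bigr (fun k : 'I_m => e1 y ^+ k)); last by move=> k _; rewrite e1_muln.
rewrite -subrX1 -e1_muln.
have : normc (e1 (y * m%:R) - 1) <= 2.
  apply: (le_trans (le_normcD _ _)).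
  by rewrite normcN normc_e1 normc1.
have := normc_ge0 (e1 (y * m%:R) - 1); move: (normc _) => z.
by move=> z0 z2; rewrite (_ : 4 = 2 ^+ 2); [rewrite lerXn2r ?nnegrE|ring].
Qed.

Lemma sum_fejer_second_moment m x : (0 < m)%N ->
  \sum_(j < m) fejer m (x - (j : nat)%:R / m%:R) *
    normc (e1 (x - (j : nat)%:R / m%:R) - 1) ^+ 2 <= 4 / m%:R.
Proof.
move=> m0; have mr0 : m%:R != 0 :> R by rewrite pnatr_eq0; lia.
apply: (le_trans (ler_sum _ (fun j _ => fejer_second_moment_le m _))).
rewrite sumr_const card_ord -[_ *+ m]mulr_natr.
by rewrite le_eqVlt; apply/orP; left; apply/eqP; field.
Qed.

End fejer1.

Section fejerd.
Context (R : realType) (d : nat).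
Local Notation C := R[i].

Definition fejerw m (x : rvec R d) (j : {ffun 'I_d -> 'I_m}) : R :=
  \prod_i fejer m ((tnth x i : R) - (j i : nat)%:R / m%:R).

Lemma fejerw_ge0 m x j : 0 <= @fejerw m x j.
Proof. by apply: prodr_ge0 => i _; exact: fejer_ge0. Qed.

Lemma sum_fejerw m x : (0 < m)%N -> \sum_j @fejerw m x j = 1.
Proof.
move=> m0; rewrite /fejerw -(bigA_distr_bigA
  (fun i (j : 'I_m) => fejer m ((tnth x i : R) - (j : nat)%:R / m%:R))).
by rewrite big1 // => i _; exact: sum_fejer.
Qed.

Lemma fejerw_second_moment m x (i : 'I_d) : (0 < m)%N ->
  \sum_j @fejerw m x j *
    normc (e1 ((tnth x i : R) - (j i : nat)%:R / m%:R) - 1) ^+ 2 <= 4 / m%:R.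
Proof.
move=> m0.
pose F l (j : 'I_m) := fejer m ((tnth x l : R) - (j : nat)%:R / m%:R) *
  (if l == i then normc (e1 ((tnth x l : R) - (j : nat)%:R / m%:R) - 1) ^+ 2 else 1).
rewrite (eq_bigr (fun j : {ffun 'I_d -> 'I_m} => \prod_l F l (j l))); last first.
  move=> j _; rewrite big_split /= -/(fejerw x j); congr (_ * _).
  by rewrite -big_mkcond /= big_pred1_eq.
rewrite -(bigA_distr_bigA F) (bigD1 i) //= [X in _ * X]big1 ?mulr1.
  rewrite /F eqxx; exact: sum_fejer_second_moment.
move=> l li; rewrite /F (negbTE li).
by under eq_bigr do rewrite mulr1; exact: sum_fejer.
Qed.

Definition gridpt m (j : {ffun 'I_d -> 'I_m}) : rvec R d :=
  [tuple (j i : nat)%:R / m%:R | i < d].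

(** A Bernstein-like operator on the torus: it averages the values of u at the
    grid points j / m, with weights that depend on x as trigonometric
    polynomials. *)
Definition fejer_op m (u : rvec R d -> C) (x : rvec R d) : C :=
  \sum_(j : {ffun 'I_d -> 'I_m}) u (gridpt j) * (fejerw x j)%:C.

Lemma fejer_op_bound m u x (M : R) : (0 < m)%N ->
  (forall y, normc (u y) <= M) -> normc (fejer_op m u x) <= M.
Proof.
move=> m0 uM; apply: (le_trans (normc_sum _ _ _)).
rewrite -[leRHS]mulr1 -(sum_fejerw x m0) mulr_sumr; apply: ler_sum => j _.
by rewrite normcM normc_real ger0_norm ?fejerw_ge0 // ler_wpM2r ?fejerw_ge0.
Qed.

(** The map e1 identifies 0 and 1, so closeness on the circle gives closeness
    in [0, 1) only around an interior point x. *)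
Lemma circle_close (x eta : R) : 0 < x < 1 -> 0 < eta ->
  exists2 del : R, 0 < del & forall y, 0 <= y < 1 ->
    normc (e1 (x - y) - 1) ^+ 2 < del -> `|x - y| < eta.
Proof.
move=> /andP[x0 x1] eta0.
have [h [h0 hx hx1 heta]] : exists h, [/\ 0 < h, h <= x, h <= 1 - x & h <= eta].
  exists (Num.min (Num.min x (1 - x)) eta).
  by rewrite !lt_min !ge_min !lexx x0 eta0 subr_gt0 x1 !orbT.
have pi0 := pi_gt0 R.
have half a : h <= a <= 1 / 2 -> sin (pi * h) <= sin (pi * a).
  move=> /andP[ha a2].
  rewrite leNgt -!cosBpihalf -cosN -[X in _ < X]cosN !opprB ltr_cos.
  - by rewrite -leNgt lerD2l lerN2 ler_pM2l.
  - by rewrite in_itv /=; apply/andP; split; nra.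
  - by rewrite in_itv /=; apply/andP; split; nra.
have sinmono a : h <= a <= 1 - h -> sin (pi * h) <= sin (pi * a).
  move=> /andP[ha ah].
  have [a2|a2] := leP a (1 / 2); first by apply: half; rewrite ha.
  rewrite -[sin (pi * a)]opprK -sinN -sinDpi.
  rewrite (_ : - (pi * a) + pi = pi * (1 - a)); last by ring.
  by apply: half; apply/andP; split; lra.
have sh0 : 0 < sin (pi * h).
  by apply: sin_gt0_pi; apply/andP; split; nra.
exists (4 * sin (pi * h) ^+ 2); first by rewrite mulr_gt0 // exprn_gt0.
move=> y /andP[y0 y1]; rewrite e1B1_sqr ltr_pM2l //.
apply: contraTT; rewrite -!leNgt => xy.
have -> : sin (pi * (x - y)) ^+ 2 = sin (pi * `|x - y|) ^+ 2.
  by case: (ler0P (x - y)) => //; rewrite mulrN sinN sqrrN.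
rewrite lerXn2r ?nnegrE ?(ltW sh0) //.
  apply: (le_trans (ltW sh0)); apply: sinmono.
  apply/andP; split; first exact: le_trans heta xy.
  by case: (ler0P (x - y)) => _; lra.
apply: sinmono; apply/andP; split; first exact: le_trans heta xy.
by case: (ler0P (x - y)) => _; lra.
Qed.

(** The argument of Bernstein and Korovkin: the oscillation of u at x' is at
    most e / 2 plus a combination of the squared distances on the d circles,
    each of which averages to at most 4 / m by fejerw_second_moment. *)
Lemma fejer_op_cvg (u : rvec R d -> C) (x x' : rvec R d) (M : R) :
  (forall y, normc (u y) <= M) ->
  (forall i, 0 < (tnth x' i : R) < 1) ->
  (forall i, exists z : int, (tnth x i : R) = tnth x' i + z%:~R) ->
  (forall e : R, 0 < e -> exists2 eta : R, 0 < eta &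
     forall y, (forall i, `|(tnth x' i : R) - tnth y i| < eta) ->
       normc (u y - u x') < e) ->
  forall e : R, 0 < e -> exists N : nat, forall m, (N <= m)%N ->
    normc (fejer_op m.+1 u x - u x') < e.
Proof.
move=> uM x'01 xx' cont e e0.
have e20 : 0 < e / 2 by rewrite divr_gt0.
have [eta eta0 ueta] := cont _ e20.
have /choice[del delP] : forall i, exists del : R, 0 < del /\
    forall y, 0 <= y < 1 ->
    normc (e1 ((tnth x' i : R) - y) - 1) ^+ 2 < del ->
    `|(tnth x' i : R) - y| < eta.
  by move=> i; have [del d0 dP] := circle_close (x'01 i) eta0; exists del.
have M0 : 0 <= M by apply: le_trans (uM x'); exact: normc_ge0.
pose K : R := \sum_i (2 * M / del i).
have K0 : 0 <= K.
  by apply: sumr_ge0 => i _; rewrite divr_ge0 ?mulr_ge0 // ltW // (delP i).1.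
exists (Num.truncn (4 * K / (e / 2))).+1 => m mN.
have m0 : 0 < m.+1%:R :> R by rewrite ltr0n.
pose D i (j : {ffun 'I_d -> 'I_m.+1}) : R :=
  normc (e1 ((tnth x i : R) - (j i : nat)%:R / m.+1%:R) - 1) ^+ 2.
have DE i j :
    D i j = normc (e1 ((tnth x' i : R) - (j i : nat)%:R / m.+1%:R) - 1) ^+ 2.
  rewrite /D; have [z ->] := xx' i.
  by rewrite addrAC [e1 (_ + z%:~R)]e1D e1_int mulr1.
have key j : normc (u (gridpt j) - u x') <= e / 2 + \sum_i 2 * M / del i * D i j.
  have term0 i : 0 <= 2 * M / del i * D i j.
    by rewrite mulr_ge0 ?sqr_ge0 // divr_ge0 ?mulr_ge0 // ltW // (delP i).1.
  case: (pselect (forall i, D i j < del i)) => [near|nnear].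
    apply: (@le_trans _ _ (e / 2)); last by rewrite lerDl sumr_ge0.
    apply/ltW/ueta => i; rewrite tnth_mktuple; apply: (delP i).2; last by rewrite -DE.
    by rewrite divr_ge0 //= ltr_pdivrMr // mul1r ltr_nat.
  have [i /negP] : exists i, ~ (D i j < del i) by apply/existsNP.
  rewrite -leNgt => far.
  apply: (@le_trans _ _ (2 * M)).
    apply: (le_trans (le_normcD _ _)); rewrite normcN.
    by have := uM (gridpt j); have := uM x'; lra.
  apply: (@le_trans _ _ (\sum_i 2 * M / del i * D i j)); last by rewrite lerDr ltW.
  rewrite (bigD1 i) //=; apply: (@le_trans _ _ (2 * M / del i * D i j)).
    rewrite mulrAC ler_pdivlMr ?(delP i).1 //.
    by rewrite ler_wpM2l // mulr_ge0.
  by rewrite lerDl sumr_ge0.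
have -> : fejer_op m.+1 u x - u x' =
    \sum_(j : {ffun 'I_d -> 'I_m.+1}) (u (gridpt j) - u x') * (fejerw x j)%:C.
  under [RHS]eq_bigr do rewrite mulrBl.
  by rewrite sumrB -mulr_sumr -rmorph_sum /= sum_fejerw // mulr1.
apply: (le_lt_trans (normc_sum _ _ _)).
apply: (@le_lt_trans _ _ (\sum_(j : {ffun 'I_d -> 'I_m.+1})
   (e / 2 + \sum_i 2 * M / del i * D i j) * fejerw x j)).
  apply: ler_sum => j _; rewrite normcM normc_real ger0_norm ?fejerw_ge0 //.
  by rewrite ler_wpM2r ?fejerw_ge0.
under eq_bigr do rewrite mulrDl mulr_suml.
rewrite big_split /= -mulr_sumr sum_fejerw // mulr1 exchange_big /=.
rewrite [ltRHS](splitr e) ltrD2l.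
apply: (@le_lt_trans _ _ (K * (4 / m.+1%:R))).
  rewrite /K mulr_suml; apply: ler_sum => i _.
  under eq_bigr do rewrite -mulrA (mulrC (D _ _)).
  rewrite -mulr_sumr ler_wpM2l //; last exact: fejerw_second_moment.
  by rewrite divr_ge0 ?mulr_ge0 // ltW // (delP i).1.
rewrite mulrA (mulrC K) ltr_pdivrMr // [ltRHS]mulrC -ltr_pdivrMr //.
apply: (lt_le_trans (truncnS_gt _)).
by rewrite ler_nat; apply: leq_trans mN _.
Qed.

End fejerd.

(** * Closed spans in L2 *)

Section cmeasurable.
Context disp (T : measurableType disp) (R : realType) (D : set T).
Local Notation C := R[i].
Implicit Types f g : T -> C.

Definition cmeas f := measurable_fun D (fun x => complex.Re (f x)) /\
  measurable_fun D (fun x => complex.Im (f x)).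

Lemma cmeas_eq f g : {in D, f =1 g} -> cmeas f -> cmeas g.
Proof.
move=> fg [mr mi]; split.
  by apply: eq_measurable_fun mr => x xD; rewrite fg.
by apply: eq_measurable_fun mi => x xD; rewrite fg.
Qed.

Lemma cmeas_cst (c : C) : cmeas (fun=> c).
Proof. by split; exact: measurable_cst. Qed.

Lemma cmeasD f g : cmeas f -> cmeas g -> cmeas (fun x => f x + g x).
Proof.
move=> [fr fi] [gr gi]; split.
  rewrite (_ : (fun x => _) =
    (fun x => complex.Re (f x)) \+ (fun x => complex.Re (g x))).
    exact: measurable_funD.
  by apply/funext => x /=; case: (f x); case: (g x).
rewrite (_ : (fun x => _) =
  (fun x => complex.Im (f x)) \+ (fun x => complex.Im (g x))).
  exact: measurable_funD.
by apply/funext => x /=; case: (f x); case: (g x).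
Qed.

Lemma cmeasM f g : cmeas f -> cmeas g -> cmeas (fun x => f x * g x).
Proof.
move=> [fr fi] [gr gi]; split.
  rewrite (_ : (fun x => _) =
    ((fun x => complex.Re (f x)) \* (fun x => complex.Re (g x))) \-
    ((fun x => complex.Im (f x)) \* (fun x => complex.Im (g x)))).
    by apply: measurable_funB; exact: measurable_funM.
  by apply/funext => x /=; case: (f x); case: (g x).
rewrite (_ : (fun x => _) =
    ((fun x => complex.Re (f x)) \* (fun x => complex.Im (g x))) \+
    ((fun x => complex.Im (f x)) \* (fun x => complex.Re (g x)))).
  by apply: measurable_funD; exact: measurable_funM.
by apply/funext => x /=; case: (f x) => a b; case: (g x).
Qed.

Lemma cmeasZ c f : cmeas f -> cmeas (fun x => c * f x).
Proof. by move=> mf; apply: cmeasM => //; exact: cmeas_cst. Qed.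

Lemma cmeasB f g : cmeas f -> cmeas g -> cmeas (fun x => f x - g x).
Proof.
move=> mf mg; apply: cmeasD => //; apply: cmeas_eq (cmeasZ (-1) mg) => x _.
by rewrite mulN1r.
Qed.

Lemma cmeas_sum (I : Type) (r : seq I) (f : I -> T -> C) :
  (forall i, cmeas (f i)) -> cmeas (fun x => \sum_(i <- r) f i x).
Proof.
move=> mf; elim: r => [|i r IH].
  by apply: cmeas_eq (cmeas_cst 0) => x _; rewrite big_nil.
by apply: cmeas_eq (cmeasD (mf i) IH) => x _; rewrite big_cons.
Qed.

Lemma cmeas_real (f : T -> R) : measurable_fun D f -> cmeas (fun x => (f x)%:C).
Proof. by move=> mf; split => //=; exact: measurable_cst. Qed.

Lemma measurable_normc_sqr f : cmeas f ->
  measurable_fun D (fun x => (normc (f x) ^+ 2)%:E).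
Proof.
move=> [mr mi]; apply/measurable_EFinP.
rewrite (_ : (fun x => _) = (fun x => complex.Re (f x) ^+ 2) \+
   (fun x => complex.Im (f x) ^+ 2)).
  by apply: measurable_funD; exact: measurable_funX.
by apply/funext => x /=; rewrite normc_sqr.
Qed.

End cmeasurable.

Lemma normc_sqr_tri (R : realType) (a b : R[i]) :
  normc (a + b) ^+ 2 <= 2 * normc a ^+ 2 + 2 * normc b ^+ 2.
Proof.
apply: (@le_trans _ _ ((normc a + normc b) ^+ 2)).
  by rewrite lerXn2r ?nnegrE ?addr_ge0 ?normc_ge0 // le_normcD.
rewrite -subr_ge0 (_ : _ - _ = (normc a - normc b) ^+ 2); first exact: sqr_ge0.
by ring.
Qed.

Section approximable.
Context disp (T : measurableType disp) (R : realType).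
Variables (mu : {measure set T -> \bar R}) (D : set T) (mD : measurable D).
Variables (J : choiceType) (I : set J) (e : J -> T -> R[i]).
Local Notation C := R[i].
Local Notation N2 := (sqr_norm2 mu D).
Implicit Types f g : T -> C.

Lemma eq_sqr_norm2 f g : {in D, f =1 g} -> N2 f = N2 g.
Proof. by move=> fg; apply: eq_integral => x xD; rewrite fg. Qed.

Lemma sqr_norm2_ge0 f : (0 <= N2 f)%E.
Proof. by apply: integral_ge0 => x _; rewrite lee_fin sqr_ge0. Qed.

Lemma sqr_norm2_tri f g : cmeas D f -> cmeas D g ->
  (N2 (fun x => f x + g x)%R <= 2%:E * N2 f + 2%:E * N2 g)%E.
Proof.
move=> mf mg.
have mf2 := measurable_normc_sqr mf; have mg2 := measurable_normc_sqr mg.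
rewrite /sqr_norm2 -!ge0_integralZl_EFin //;
  try by move=> x _; rewrite lee_fin sqr_ge0.
rewrite -ge0_integralD //; first last.
- exact: measurable_funeM.
- by move=> x _; rewrite -EFinM lee_fin mulr_ge0 // sqr_ge0.
- exact: measurable_funeM.
- by move=> x _; rewrite -EFinM lee_fin mulr_ge0 // sqr_ge0.
apply: ge0_le_integral => //.
- by move=> x _; rewrite lee_fin sqr_ge0.
- exact/measurable_normc_sqr/cmeasD.
- by apply: emeasurable_funD; exact: measurable_funeM.
- by move=> x _; rewrite -!EFinM -EFinD lee_fin normc_sqr_tri.
Qed.

Lemma sqr_norm2_tri_lt f g (eps : R) : cmeas D f -> cmeas D g ->
  (N2 f < (eps / 4)%:E)%E -> (N2 g < (eps / 4)%:E)%E ->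
  (N2 (fun x => f x + g x)%R < eps%:E)%E.
Proof.
move=> mf mg fe ge; apply: (le_lt_trans (sqr_norm2_tri mf mg)).
have -> : eps%:E = (2%:E * (eps / 4)%:E + 2%:E * (eps / 4)%:E)%E.
  by rewrite -!EFinM -EFinD; congr EFin; field.
by apply: lteD; rewrite lte_pmul2l.
Qed.

Lemma sqr_norm2Z c f : cmeas D f ->
  N2 (fun x => c * f x)%R = ((normc c ^+ 2)%:E * N2 f)%E.
Proof.
move=> mf; rewrite /sqr_norm2 -ge0_integralZl_EFin ?sqr_ge0 //.
- by apply: eq_integral => x _; rewrite normcM exprMn EFinM.
- by move=> x _; rewrite lee_fin sqr_ge0.
- exact: measurable_normc_sqr.
Qed.

(** The closed linear span in L2 of the e i, i in I, among measurable functions.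
    Measurability is part of the notion because every closure property below
    needs it to estimate the L2 norm of a sum. *)
Definition approximable f := cmeas D f /\
  forall eps : R, 0 < eps ->
    exists (n : nat) (i : 'I_n -> J) (c : 'I_n -> C),
      (forall k, I (i k)) /\
      (N2 (fun x => f x - \sum_(k < n) c k * e (i k) x)%R < eps%:E)%E.

Hypothesis me : forall i, I i -> cmeas D (e i).

Lemma approximable_eq f g : {in D, f =1 g} -> approximable f -> approximable g.
Proof.
move=> fg [mf af]; split; first exact: cmeas_eq mf.
move=> eps /af[n [i [c [Ii lt]]]]; exists n, i, c; split=> //.
rewrite (@eq_sqr_norm2 _ (fun x => f x - \sum_(k < n) c k * e (i k) x)) //.
by move=> x xD; rewrite fg.
Qed.

Lemma approximable_base i : I i -> approximable (e i).
Proof.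
move=> Ii; split; first exact: me.
move=> eps eps0; exists 1, (fun=> i), (fun=> 1); split=> //.
rewrite (@eq_sqr_norm2 _ (fun=> 0)); last first.
  by move=> x _; rewrite big_ord1 mul1r subrr.
by rewrite /sqr_norm2 normc0 expr0n /= integral0 lte_fin.
Qed.

Lemma cmeas_comb n (i : 'I_n -> J) (c : 'I_n -> C) : (forall k, I (i k)) ->
  cmeas D (fun x => \sum_(k < n) c k * e (i k) x).
Proof. by move=> Ii; apply: cmeas_sum => k; exact/cmeasZ/me. Qed.

Lemma approximableD f g : approximable f -> approximable g ->
  approximable (fun x => f x + g x).
Proof.
move=> [mf af] [mg ag]; split; first exact: cmeasD.
move=> eps eps0; have eps4 : 0 < eps / 4 by rewrite divr_gt0.
have [n [i [c [Ii lti]]]] := af _ eps4.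
have [m [j [b [Ij ltj]]]] := ag _ eps4.
exists (n + m)%N.
exists (fun k => match fintype.split k with inl k => i k | inr k => j k end).
exists (fun k => match fintype.split k with inl k => c k | inr k => b k end).
split; first by move=> k; case: (fintype.split k).
rewrite (@eq_sqr_norm2 _ (fun x => (f x - \sum_(k < n) c k * e (i k) x) +
   (g x - \sum_(k < m) b k * e (j k) x))); last first.
  move=> x _; rewrite big_split_ord /=.
  under [X in _ - (X + _)]eq_bigr => k _ do
    rewrite -[lshift m k]/(unsplit (inl k)) unsplitK.
  under [X in _ - (_ + X)]eq_bigr => k _ do
    rewrite -[rshift n k]/(unsplit (inr k)) unsplitK.
  by rewrite opprD addrACA.
by apply: sqr_norm2_tri_lt => //; apply: cmeasB => //; exact: cmeas_comb.
Qed.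

Lemma approximable_lim f : cmeas D f ->
  (forall eps : R, 0 < eps -> exists2 g, approximable g &
     (N2 (fun x => f x - g x)%R < eps%:E)%E) -> approximable f.
Proof.
move=> mf fg; split=> // eps eps0; have eps4 : 0 < eps / 4 by rewrite divr_gt0.
have [g [mg ag] ltg] := fg _ eps4; have [n [i [c [Ii lti]]]] := ag _ eps4.
exists n, i, c; split=> //.
rewrite (@eq_sqr_norm2 _ (fun x => (f x - g x) +
   (g x - \sum_(k < n) c k * e (i k) x))); last by move=> x _; rewrite addrA subrK.
by apply: sqr_norm2_tri_lt => //; apply: cmeasB => //; exact: cmeas_comb.
Qed.

Lemma approximableZ a f : approximable f -> approximable (fun x => a * f x).
Proof.
move=> [mf af]; split; first exact: cmeasZ.
move=> eps eps0.
have a1 : 0 < normc a ^+ 2 + 1 by rewrite ltr_wpDl // sqr_ge0.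
have [n [i [c [Ii lti]]]] := af _ (divr_gt0 eps0 a1).
exists n, i, (fun k => a * c k); split=> //.
rewrite (@eq_sqr_norm2 _
  (fun x => a * (f x - \sum_(k < n) c k * e (i k) x))); last first.
  by move=> x _; rewrite mulrBr mulr_sumr; under [in RHS]eq_bigr do rewrite mulrA.
rewrite sqr_norm2Z; last by apply: cmeasB => //; exact: cmeas_comb.
apply: (@le_lt_trans _ _ ((normc a ^+ 2 + 1)%:E *
    N2 (fun x => f x - \sum_(k < n) c k * e (i k) x)%R)%E).
  by rewrite lee_wpmul2r ?sqr_norm2_ge0 // lee_fin lerDl.
have -> : eps%:E = ((normc a ^+ 2 + 1)%:E * (eps / (normc a ^+ 2 + 1))%:E)%E.
  by rewrite -EFinM mulrC divfK // gt_eqF.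
by rewrite lte_pmul2l.
Qed.

Lemma approximable0 : approximable (fun=> 0).
Proof.
split; first exact: cmeas_cst.
move=> eps eps0.
exists 0, (fun i : 'I_0 => False_rect _ (notF (ltn_ord i))), (fun=> 0).
split; first by case.
rewrite (@eq_sqr_norm2 _ (fun=> 0)); last first.
  by move=> x _; rewrite big_ord0 subrr.
by rewrite /sqr_norm2 normc0 expr0n /= integral0 lte_fin.
Qed.

Lemma approximable_sum (K : Type) (r : seq K) (f : K -> T -> C) :
  (forall i, approximable (f i)) -> approximable (fun x => \sum_(i <- r) f i x).
Proof.
move=> af; elim: r => [|i r IH].
  by apply: approximable_eq approximable0 => x _; rewrite big_nil.
by apply: approximable_eq (approximableD (af i) IH) => x _; rewrite big_cons.
Qed.

(** Dominated convergence applied to the squared distance between f and g_ n. *)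
Lemma approximable_dominated (g_ : nat -> T -> C) f (h : T -> R) :
  (forall n, approximable (g_ n)) -> cmeas D f ->
  mu.-integrable D (EFin \o h) ->
  (forall n x, D x -> normc (g_ n x) ^+ 2 <= h x) ->
  (forall x, D x -> normc (f x) ^+ 2 <= h x) ->
  {ae mu, forall x, D x -> forall eps : R, 0 < eps ->
     exists N, forall n, (N <= n)%N -> normc (g_ n x - f x) < eps} ->
  approximable f.
Proof.
move=> ag mf ih gh fh gf; apply: approximable_lim => // eps eps0.
pose F n x := (normc (f x - g_ n x) ^+ 2)%:E.
have mF n : measurable_fun D (F n).
  by apply: measurable_normc_sqr; apply: cmeasB => //; exact: (ag n).1.
have [] := @dominated_convergence _ _ _ mu D mD F (cst 0%E)
    (fun x => 4%:E * (EFin \o h) x)%E mF (measurable_cst _) _ (integrableZl mD _ ih) _.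
- apply: filterS gf => x gfx Dx.
  apply: cvg_EFin; first by apply: nearW => n.
  apply/cvgrPdist_lt => r r0.
  have sr0 : 0 < Num.sqrt r by rewrite sqrtr_gt0.
  have [N NP] := gfx Dx _ sr0.
  exists N => // n /= Nn; rewrite sub0r normrN ger0_norm ?sqr_ge0 //.
  rewrite -(sqr_sqrtr (ltW r0)) ltrXn2r ?nnegrE ?normc_ge0 ?sqrtr_ge0 //.
  by rewrite -normcN opprB; exact: NP.
- apply: aeW => x n Dx; rewrite /F /= ger0_norm ?sqr_ge0 //.
  rewrite -EFinM lee_fin.
  apply: (le_trans (normc_sqr_tri _ _)); rewrite normcN.
  by have := gh n x Dx; have := fh x Dx; lra.
move=> _ _; rewrite integral0 => /fine_cvgP[fin].
move=> /cvgrPdist_lt /(_ _ eps0) lt.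
have [n [finn ltn]] := @filter_ex _ _ _ _ (filterI fin lt).
exists (g_ n); first exact: ag.
move: ltn; rewrite sub0r normrN => ltn.
rewrite -[X in (X < _)%E](fineK finn) lte_fin.
exact: le_lt_trans (ler_norm _) ltn.
Qed.

End approximable.

(** * Trigonometric polynomials *)

Section trig.
Context (R : realType) (d : nat).
Local Notation C := R[i].

(** Trigonometric polynomials with integer frequencies. The inductive form
    makes every property that is stable under linear combinations immediate,
    and closure under products a double induction. *)
Inductive trig : (rvec R d -> C) -> Prop :=
| trig_char (m : d.-tuple int) : trig (fun x => e1 (dotp x (int_rvec R m)))
| trigD f g : trig f -> trig g -> trig (fun x => f x + g x)
| trigZ c f : trig f -> trig (fun x => c * f x).

Lemma dotp_intD (x : rvec R d) (m n : d.-tuple int) :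
  dotp x (int_rvec R m) + dotp x (int_rvec R n) =
  dotp x (int_rvec R [tuple tnth m i + tnth n i | i < d]).
Proof.
rewrite /dotp -big_split; apply: eq_bigr => i _ /=.
by rewrite !tnth_mktuple intrD mulrDr.
Qed.

Lemma trigM f g : trig f -> trig g -> trig (fun x => f x * g x).
Proof.
move=> tf; elim: tf g => [m|f1 f2 _ IH1 _ IH2|c f1 _ IH] g tg.
- elim: tg => [n|g1 g2 _ IH1 _ IH2|c g1 _ IH].
  + rewrite (_ : (fun x => _) = (fun x => e1 (dotp x
      (int_rvec R [tuple tnth m i + tnth n i | i < d])))); first exact: trig_char.
    by apply/funext => x; rewrite -e1D dotp_intD.
  + rewrite (_ : (fun x => _) = (fun x => e1 (dotp x (int_rvec R m)) * g1 x +
      e1 (dotp x (int_rvec R m)) * g2 x)); first exact: trigD.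
    by apply/funext => x; rewrite mulrDr.
  + rewrite (_ : (fun x => _) = (fun x => c * (e1 (dotp x (int_rvec R m)) * g1 x))).
      exact: trigZ.
    by apply/funext => x; rewrite mulrCA.
- rewrite (_ : (fun x => _) = (fun x => f1 x * g x + f2 x * g x)).
    by apply: trigD; [exact: IH1|exact: IH2].
  by apply/funext => x; rewrite mulrDl.
- rewrite (_ : (fun x => _) = (fun x => c * (f1 x * g x))).
    by apply: trigZ; exact: IH.
  by apply/funext => x; rewrite mulrA.
Qed.

Lemma trig_cst c : trig (fun=> c).
Proof.
rewrite (_ : (fun=> c) = (fun x => c * e1 (dotp x (int_rvec R [tuple 0 | _ < d])))).
  exact/trigZ/trig_char.
apply/funext => x; rewrite /dotp big1 ?e10 ?mulr1 // => i _.
by rewrite !tnth_mktuple mulr0.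
Qed.

Lemma trig_sum (I : Type) (r : seq I) (f : I -> rvec R d -> C) :
  (forall i, trig (f i)) -> trig (fun x => \sum_(i <- r) f i x).
Proof.
move=> tf; elim: r => [|i r IH].
  rewrite (_ : (fun=> _) = fun=> 0); first exact: trig_cst.
  by apply/funext => x; rewrite big_nil.
rewrite (_ : (fun=> _) = fun x => f i x + \sum_(j <- r) f j x); first exact: trigD.
by apply/funext => x; rewrite big_cons.
Qed.

Lemma trig_prod (I : Type) (r : seq I) (f : I -> rvec R d -> C) :
  (forall i, trig (f i)) -> trig (fun x => \prod_(i <- r) f i x).
Proof.
move=> tf; elim: r => [|i r IH].
  rewrite (_ : (fun=> _) = fun=> 1); first exact: trig_cst.
  by apply/funext => x; rewrite big_nil.
rewrite (_ : (fun=> _) = fun x => f i x * \prod_(j <- r) f j x); first exact: trigM.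
by apply/funext => x; rewrite big_cons.
Qed.

Lemma trig_coord (i : 'I_d) (m : int) (a : R) :
  trig (fun x => e1 ((tnth x i - a) * m%:~R)).
Proof.
rewrite (_ : (fun=> _) = (fun x => e1 (- a * m%:~R) *
   e1 (dotp x (int_rvec R [tuple if l == i then m else 0 | l < d])))).
  exact/trigZ/trig_char.
apply/funext => x; rewrite -e1D; congr e1.
rewrite /dotp (bigD1 i) //= big1 ?addr0 ?tnth_mktuple ?eqxx; first by ring.
by move=> l li; rewrite !tnth_mktuple (negbTE li) mulr0.
Qed.

Lemma trig_fejer_op m (u : rvec R d -> C) : trig (fejer_op m u).
Proof.
apply: trig_sum => j.
apply: trigM; first exact: trig_cst.
rewrite (_ : (fun=> _) = fun x => \prod_(i < d)
    (fejer m ((tnth x i : R) - (j i : nat)%:R / m%:R))%:C); last first.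
  by apply/funext => x; rewrite /fejerw rmorph_prod.
apply: trig_prod => i.
rewrite (_ : (fun=> _) = (fun x => (m%:R ^- 2)%:C *
  ((\sum_(l < m)
      e1 (((tnth x i : R) - (j i : nat)%:R / m%:R) * (l : nat)%:Z%:~R)) *
   (\sum_(l < m)
      e1 (((tnth x i : R) - (j i : nat)%:R / m%:R) * (- (l : nat)%:Z)%:~R))))).
  by apply: trigZ; apply: trigM; apply: trig_sum => l; exact: trig_coord.
apply/funext => x; rewrite fejerE mulrC; congr (_ * (_ * _)).
by apply: eq_bigr => l _; rewrite mulrNz mulNr mulrN.
Qed.

End trig.

Section cmeas_characters.
Context (R : realType) (d : nat).
Local Notation C := R[i].

Lemma measurable_dotp (xi : rvec R d) (D : set (rvec R d)) :
  measurable_fun D (fun x => dotp x xi).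
Proof.
apply: measurable_funTS; rewrite /dotp.
apply: (measurable_sum _ (h := fun (i : 'I_d) (x : rvec R d) =>
  (tnth x i : R) * tnth xi i)) => i.
apply: measurable_funM; last exact: measurable_cst.
exact: measurable_tnth.
Qed.

Lemma cmeas_e1 (g : rvec R d -> R) (D : set (rvec R d)) : measurable_fun D g ->
  cmeas D (fun x => e1 (g x)).
Proof.
move=> mg; have mg2 : measurable_fun D (fun x => 2 * pi * g x).
  by apply: measurable_funM => //; exact: measurable_cst.
split.
  apply: (measurableT_comp _ mg2); apply: continuous_measurable_fun.
  exact: continuous_cos.
apply: (measurableT_comp _ mg2); apply: continuous_measurable_fun.
exact: continuous_sin.
Qed.

Lemma cmeas_shift (t : rvec R d) (f : rvec R d -> C) :
  cmeas setT f -> cmeas setT (fun x => f (shift t x)).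
Proof.
move=> [mr mi]; split.
  exact: (measurableT_comp mr (measurable_shift t)).
exact: (measurableT_comp mi (measurable_shift t)).
Qed.

Lemma cmeas_indic (A D : set (rvec R d)) : measurable A ->
  cmeas D (fun x => (\1_A x : R)%:C).
Proof. by move=> mA; apply: cmeas_real; exact: measurable_indic. Qed.

Lemma cmeasS (f : rvec R d -> C) (D : set (rvec R d)) : cmeas setT f -> cmeas D f.
Proof. by move=> [mr mi]; split; apply: measurable_funTS. Qed.

Lemma dotp_shift (t x xi : rvec R d) : dotp (shift t x) xi = dotp t xi + dotp x xi.
Proof.
rewrite /dotp -big_split; apply: eq_bigr => i _.
by rewrite tnth_shift mulrDl.
Qed.

Lemma dotp_shiftr (t x xi : rvec R d) : dotp x (shift t xi) = dotp x t + dotp x xi.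
Proof.
rewrite /dotp -big_split; apply: eq_bigr => i _.
by rewrite tnth_shift mulrDr.
Qed.

Lemma dotp_int (m n : d.-tuple int) : exists z : int,
  dotp (int_rvec R m) (int_rvec R n) = z%:~R.
Proof.
exists (\sum_(i < d) tnth m i * tnth n i).
rewrite /dotp rmorph_sum; apply: eq_bigr => i _ /=.
by rewrite !tnth_mktuple intrM.
Qed.

Lemma e1_continuous (a e : R) : 0 < e -> exists2 del : R, 0 < del &
  forall b, `|a - b| < del -> normc (e1 b - e1 a) < e.
Proof.
move=> e0; have e2 : 0 < e / 2 by rewrite divr_gt0.
have /cvgrPdist_lt /(_ _ e2) := @continuous_sin R 0.
rewrite sin0 => -[r r0 rP]; have {}r0 : 0 < r by [].
have pi0 := pi_gt0 R.
exists (r / pi); first by rewrite divr_gt0.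
move=> b ab.
rewrite (_ : e1 b - e1 a = e1 a * (e1 (b - a) - 1)); last first.
  by rewrite mulrBr mulr1 -e1D [a + _]addrC subrK.
rewrite normcM normc_e1 mul1r.
rewrite -(@ltr_pXn2r _ 2) ?nnegrE ?normc_ge0 ?(ltW e0) // e1B1_sqr.
have h : `|0 - pi * (b - a)| < r -> `|0 - sin (pi * (b - a))| < e / 2 := rP _.
rewrite !sub0r !normrN in h.
have {}h : `|sin (pi * (b - a))| < e / 2.
  apply: h; rewrite normrM (gtr0_norm pi0) mulrC -ltr_pdivlMr //.
  by rewrite distrC.
rewrite -(real_normK (num_real (sin _))).
have := normr_ge0 (sin (pi * (b - a))); move: h; move: `|_| => z; nra.
Qed.

Lemma e1_dotp_continuous (xi x : rvec R d) (e : R) : 0 < e ->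
  exists2 eta : R, 0 < eta & forall y,
    (forall i, `|(tnth x i : R) - tnth y i| < eta) ->
    normc (e1 (- dotp y xi) - e1 (- dotp x xi)) < e.
Proof.
move=> e0; have [del del0 delP] := e1_continuous (- dotp x xi) e0.
pose S : R := \sum_(i < d) `|tnth xi i : R| + 1.
have S0 : 0 < S by rewrite ltr_wpDl // sumr_ge0.
exists (del / S); first by rewrite divr_gt0.
move=> y xy; apply: delP.
rewrite opprK addrC /dotp -sumrB.
apply: (le_lt_trans (ler_norm_sum _ _ _)).
apply: (@le_lt_trans _ _ (del / S * \sum_(i < d) `|tnth xi i : R|)).
  rewrite mulr_sumr; apply: ler_sum => i _.
  rewrite -mulrBl normrM ler_wpM2r // distrC ltW //; exact: xy.
rewrite mulrAC ltr_pdivrMr // ltr_pM2l //.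
by rewrite /S ltrDl.
Qed.

End cmeas_characters.

(** * Orthants and fractional parts *)

Section orthants.
Context (R : realType) (d : nat).
Let mu := lebesgue_measure_rvec R d.

Definition orthant (a : rvec R d) : set (rvec R d) :=
  [set x | forall i, (tnth a i : R) < tnth x i].

Lemma measurable_orthant a : measurable (orthant a).
Proof.
rewrite (_ : orthant a =
  [set x | forall i, (fun i => [set` `](tnth a i : R), +oo[]) i (tnth x i)]).
  apply: (measurable_box (A := fun i => [set` `](tnth a i : R), +oo[])) => i.
  exact: measurable_itv.
by apply/seteqP; split=> x /= H i; have := H i; rewrite in_itv /= andbT.
Qed.

Lemma orthant_setI : setI_closed [set orthant a | a in [set: rvec R d]].
Proof.
move=> _ _ [a _ <-] [b _ <-].
exists [tuple Num.max (tnth a i : R) (tnth b i) | i < d] => //.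
apply/seteqP; split=> x /=.
  by move=> H; split=> i; have := H i; rewrite tnth_mktuple gt_max => /andP[].
by move=> [Ha Hb] i; rewrite tnth_mktuple gt_max; apply/andP; split;
  [exact: Ha|exact: Hb].
Qed.

(** A half-space x_i > a is the union of the orthants whose other corners are
    at -n, and half-spaces generate the product sigma-algebra. *)
Lemma tuple_measurableE :
  @measurable _ (rvec R d) = <<s [set orthant a | a in [set: rvec R d]] >>.
Proof.
apply/seteqP; split; last first.
  apply: smallest_sub; first exact: sigma_algebra_measurable.
  by move=> _ [a _ <-]; exact: measurable_orthant.
pose T' := g_sigma_algebraType [set orthant a | a in [set: rvec R d]].
have mi i : measurable_fun [set: T']
    (fun x : T' => tnth (x : rvec R d) i : measurableTypeR R).
  apply: (measurability _ (RGenOInfty.measurableE R)) => // _ [_ [a ->] <-].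
  rewrite setTI.
  pose b n : rvec R d := [tuple if l == i then a else - n%:R | l < d].
  rewrite (_ : _ @^-1` _ = \bigcup_n orthant (b n)).
    apply: bigcup_measurable => n _; apply: sub_sigma_algebra.
    by exists (b n).
  apply/seteqP; split=> x /=.
    rewrite in_itv /= andbT => ax.
    pose S := \sum_(l < d) `|tnth x l : R|.
    exists (Num.truncn S).+1 => // l; rewrite tnth_mktuple.
    case: eqP => [->//|_]; rewrite ltrNl.
    apply: (@le_lt_trans _ _ S); last exact: truncnS_gt.
    rewrite /S (bigD1 l) //= -[leLHS]addr0; apply: lerD; last exact: sumr_ge0.
    by rewrite -normrN; exact: ler_norm.
  move=> [n _ /(_ i)]; rewrite tnth_mktuple eqxx in_itv /= andbT; exact.
have mid : measurable_fun [set: T'] (fun x : T' => x : rvec R d).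
  exact/measurable_fun_tnthP.
move=> A mA; have := mid measurableT A mA; rewrite setTI; exact.
Qed.

Lemma negligible_countable_coord (i : 'I_d) (c : set (measurableTypeR R)) :
  countable c -> mu.-negligible [set x : rvec R d | c (tnth x i)].
Proof.
move=> cc.
have mc : measurable c by apply: countable_measurable => // t; exact: measurable_set1.
pose A l : set (measurableTypeR R) := if l == i then c else setT.
have mA l : measurable (A l) by rewrite /A; case: ifP.
have A0 : mu [set x | forall l, A l (tnth x l)] = 0%E.
  rewrite /mu lebesgue_measure_rvec_box // (bigD1 i) //= {1}/A eqxx.
  have -> : lebesgue_measure c = 0%E by exact: countable_lebesgue_measure0.
  by rewrite mul0e.
rewrite (_ : [set x | _] = [set x | forall l, A l (tnth x l)]).
  by apply/negligibleP => //; exact: measurable_box.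
apply/seteqP; split=> x /=; last by move=> /(_ i); rewrite /A eqxx.
by move=> cx l; rewrite /A; case: eqP => [->|].
Qed.

Lemma ae_avoid_translates (a : rvec R d) :
  {ae mu, forall x, forall i (z : int), (tnth x i : R) != tnth a i + z%:~R}.
Proof.
pose c i : set (measurableTypeR R) :=
  range (fun z : int => (tnth a i : R) + z%:~R).
have cc i : countable (c i).
  by apply: (sub_countable (card_image_le _ _)); exact: countableP.
have : mu.-negligible (\bigcup_(i in [set` enum 'I_d])
    [set x : rvec R d | c i (tnth x i)]).
  by apply: negligible_bigcup_seq => i _; exact: negligible_countable_coord.
apply: negligibleS => x; apply: contra_notP => nx i z.
apply/negP => /eqP xz; apply: nx.
by exists i; [rewrite /= mem_enum|exists z].
Qed.

Definition locally_constant (B : set (rvec R d)) (x : rvec R d) : Prop :=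
  exists2 eta : R, 0 < eta & forall y,
    (forall i, `|(tnth x i : R) - tnth y i| < eta) -> B y <-> B x.

Lemma locally_constant_orthant (a x : rvec R d) :
  (forall i, (tnth x i : R) != tnth a i) -> locally_constant (orthant a) x.
Proof.
move=> xa.
pose eta : R := \big[Num.min/1]_(i < d) `|(tnth x i : R) - tnth a i|.
have eta0 : 0 < eta.
  rewrite /eta; elim/big_ind : _ => //; first by move=> u v u0 v0; rewrite lt_min u0.
  by move=> i _; rewrite normr_gt0 subr_eq0.
have etai i : eta <= `|(tnth x i : R) - tnth a i| by exact: bigmin_le_cond.
exists eta => // y xy; split=> H i.
  have := H i; have := xy i; have := etai i; have := xa i.
  move: (tnth x i : R) (tnth y i : R) (tnth a i : R) => p q r pr.
  by case: (ler0P (p - r)); case: (ler0P (p - q)); lra.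
have := H i; have := xy i; have := etai i.
move: (tnth x i : R) (tnth y i : R) (tnth a i : R) => p q r.
by case: (ler0P (p - r)); case: (ler0P (p - q)); lra.
Qed.

Lemma ae_locally_constant_orthant (a : rvec R d) :
  {ae mu, forall x, forall z : d.-tuple int,
    locally_constant (orthant a) (shift (int_rvec R z) x)}.
Proof.
apply: negligibleS (ae_avoid_translates a) => x; apply: contra_not => xa z.
apply: locally_constant_orthant => i; rewrite tnth_shift tnth_mktuple.
apply/eqP => E; have /eqP := xa i (- tnth z i); apply.
by rewrite mulrNz -E addrAC subrr add0r.
Qed.

Lemma ae_locally_constantT :
  {ae mu, forall x, forall z : d.-tuple int,
    locally_constant setT (shift (int_rvec R z) x)}.
Proof. by apply: aeW => x z; exists 1. Qed.

Definition fracv (x : rvec R d) : rvec R d :=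
  shift (oppv (int_rvec R (floorv x))) x.

Lemma fracv_range x i : 0 <= (tnth (fracv x) i : R) < 1.
Proof.
have : Num.floor (tnth x i : R) == tnth (floorv x) i by rewrite tnth_mktuple.
rewrite floor_eq intrD tnth_shift tnth_oppv [tnth (int_rvec _ _) _]tnth_mktuple.
by lra.
Qed.

Lemma shift_fracv x : shift (int_rvec R (floorv x)) (fracv x) = x.
Proof. exact: shiftKN. Qed.

Lemma ae_fracv_interior :
  {ae mu, forall x, forall i, 0 < (tnth (fracv x) i : R) < 1}.
Proof.
apply: negligibleS (ae_avoid_translates [tuple 0 | _ < d]) => x.
apply: contra_not => xa i.
have /andP[f0 ->] := fracv_range x i; rewrite andbT lt_neqAle f0 andbT.
apply/eqP => E; have /eqP := xa i (tnth (floorv x) i); apply.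
rewrite tnth_mktuple add0r; move: E; rewrite tnth_shift tnth_oppv tnth_mktuple.
by move/eqP; rewrite eq_sym addrC subr_eq0 => /eqP.
Qed.

End orthants.

(** * Density of the exponentials on a union of cubes *)

Section density.
Context (R : realType) (d k : nat).
Variables (s : 'I_k -> d.-tuple int) (lam : 'I_k -> rvec R d).
Local Notation C := R[i].
Local Notation S j := (int_rvec R (s j)).
Hypothesis k0 : (0 < k)%N.
Hypothesis orth : forall p q,
  \sum_(j < k) e1 (dotp (S j) (lam p) - dotp (S j) (lam q)) = (k * (p == q))%:R.
Let mu := lebesgue_measure_rvec R d.
Let Omega := cube_union R s.

(** The matrix e1 (s j . lam p) / sqrt k is unitary, so its columns are
    orthonormal because its rows are. *)
Lemma dual_orth i j :
  \sum_(p < k) e1 (dotp (S i) (lam p) - dotp (S j) (lam p)) = (k * (i == j))%:R.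
Proof.
have kC : k%:R != 0 :> C by rewrite pnatr_eq0 -lt0n.
pose U : 'M[C]_k := \matrix_(p, j) e1 (dotp (S j) (lam p)).
pose V : 'M[C]_k := \matrix_(j, q) (e1 (- dotp (S j) (lam q)) / k%:R).
have UV : U *m V = 1%:M.
  apply/matrixP => p q; rewrite !mxE.
  rewrite (eq_bigr (fun j => e1 (dotp (S j) (lam p) - dotp (S j) (lam q)) / k%:R)).
    rewrite -mulr_suml orth; case: eqP => _; first by rewrite muln1 divff.
    by rewrite muln0 mul0r.
  by move=> l _; rewrite !mxE mulrA -e1D.
have /matrixP/(_ j i) := mulmx1C UV; rewrite !mxE => E.
transitivity (k%:R * \sum_(l < k) V j l * U l i).
  rewrite mulr_sumr; apply: eq_bigr => l _; rewrite !mxE.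
  by rewrite mulrA mulrCA mulfV // mulr1 -e1D addrC.
by rewrite E eq_sym natrM.
Qed.

Lemma orth_inj : injective s.
Proof.
move=> i j ij; have := dual_orth i j.
rewrite ij (eq_bigr (fun=> 1)); last by move=> p _; rewrite subrr e10.
rewrite sumr_const card_ord => /eqP; rewrite eqr_nat.
by case: (i =P j) => //; rewrite muln0 eqn0Ngt k0.
Qed.

Definition shifted_freqs : set (rvec R d) :=
  [set xi | exists p (m : d.-tuple int), xi = shift (int_rvec R m) (lam p)].

Lemma measure_orth_union : mu Omega = k%:R%:E.
Proof. exact/measure_cube_union/orth_inj. Qed.

Lemma cube_union_floorv x : Omega x <-> exists i, s i = floorv x.
Proof. by rewrite /Omega cube_unionE. Qed.

Lemma normalized_expE xi x :
  normalized_exp Omega xi x = ((Num.sqrt k%:R)^-1)%:C * e1 (dotp x xi).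
Proof. by rewrite /normalized_exp -/mu measure_orth_union. Qed.

Lemma sqrtk0 : (Num.sqrt k%:R : R) != 0.
Proof. by rewrite sqrtr_eq0 -ltNge ltr0n. Qed.

Lemma cmeas_normalized_exp xi D : cmeas D (normalized_exp Omega xi).
Proof.
rewrite (_ : normalized_exp _ _ =
  fun x => ((Num.sqrt k%:R)^-1)%:C * e1 (dotp x xi)).
  by apply: cmeasZ; apply: (cmeas_e1 (g := fun x => dotp x xi)); exact: measurable_dotp.
by apply/funext => x; exact: normalized_expE.
Qed.

Notation V := (approximable mu Omega shifted_freqs (normalized_exp Omega)).
Let mO : measurable Omega := measurable_cube_union s.
Let mexp : forall i, shifted_freqs i -> cmeas Omega (normalized_exp Omega i).
Proof. by move=> i _; exact: cmeas_normalized_exp. Qed.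

Lemma approximable_trig p f : trig f -> V (fun x => e1 (dotp x (lam p)) * f x).
Proof.
elim=> [m|f1 f2 _ V1 _ V2|c f1 _ V1].
- have Vb : V (normalized_exp Omega (shift (int_rvec R m) (lam p))).
    by apply: approximable_base => //; exists p, m.
  apply: approximable_eq (approximableZ mO mexp (Num.sqrt k%:R)%:C Vb) => x _ /=.
  rewrite normalized_expE mulrA -rmorphM /= divff ?sqrtk0 // mul1r.
  by rewrite dotp_shiftr e1D mulrC.
- apply: approximable_eq (approximableD mO mexp V1 V2) => x _ /=.
  by rewrite mulrDr.
- by apply: approximable_eq (approximableZ mO mexp c V1) => x _ /=; rewrite mulrCA.
Qed.

(** On the cell of s i the fractional part is a translation, and Omega is the
    finite union of these cells. *)
Lemma cmeas_fracv (u : rvec R d -> C) : cmeas setT u ->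
  cmeas Omega (fun x => u (fracv x)).
Proof.
move=> mu'.
pose cell i := translate (S i) (unit_cube R d).
apply: (@cmeas_eq _ _ _ _ (fun x => \sum_(i < k)
    (\1_(cell i) x : R)%:C * u (shift (oppv (S i)) x))).
  move=> x /set_mem /cube_union_floorv[i ix].
  rewrite (bigD1 i) //= big1 ?addr0; last first.
    move=> j ji; rewrite indicE memNset ?mul0r // /cell translate_cubeE /= -ix.
    by move=> /orth_inj ij; rewrite ij eqxx in ji.
  by rewrite indicE mem_set ?mul1r /fracv -?ix // /cell translate_cubeE.
apply: cmeas_sum => i; apply: cmeasM.
  by apply: cmeas_indic; exact: measurable_translate_cube.
exact/cmeasS/cmeas_shift.
Qed.

Lemma integrable_cst_Omega (c : R) : mu.-integrable Omega (EFin \o cst c).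
Proof.
apply/integrableP; split; first by apply/measurable_EFinP; exact: measurable_cst.
rewrite (_ : (\int[mu]_(x in Omega) _)%E = (`|c|%:E * mu Omega)%E).
  by rewrite measure_orth_union -EFinM ltry.
rewrite -(@lebesgue_integral_nonneg.integral_cst _ _ _ mu Omega (measurable_cube_union s)) //.
Qed.

(** The operators fejer_op m u are trigonometric polynomials, they are bounded
    by M, and they converge to u (fracv x) wherever u is continuous. *)
Lemma approximable_fracv p (u : rvec R d -> C) (M : R) : cmeas setT u ->
  (forall y, normc (u y) <= M) ->
  {ae mu, forall x, forall e : R, 0 < e -> exists2 eta : R, 0 < eta &
     forall y, (forall i, `|(tnth (fracv x) i : R) - tnth y i| < eta) ->
       normc (u y - u (fracv x)) < e} ->
  V (fun x => e1 (dotp x (lam p)) * u (fracv x)).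
Proof.
move=> mu' uM cont.
have M0 : 0 <= M by apply: le_trans (uM (lam p)); exact: normc_ge0.
have bound (z w : C) : normc z = 1 -> normc w <= M -> normc (z * w) ^+ 2 <= M ^+ 2.
  by move=> z1 wM; rewrite normcM z1 mul1r lerXn2r ?nnegrE ?normc_ge0.
apply: (@approximable_dominated _ _ _ mu Omega mO _ _ _ mexp
  (fun m x => e1 (dotp x (lam p)) * fejer_op m.+1 u x) _ (cst (M ^+ 2))).
- by move=> m; apply: approximable_trig; exact: trig_fejer_op.
- apply: cmeasM; last exact: cmeas_fracv.
  by apply: (cmeas_e1 (g := fun x => dotp x (lam p))); exact: measurable_dotp.
- exact: integrable_cst_Omega.
- by move=> m x _; apply: bound; [exact: normc_e1|exact: fejer_op_bound].
- by move=> x _; apply: bound; [exact: normc_e1|exact: uM].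
have := negligibleU cont (@ae_fracv_interior R d).
apply: negligibleS => x; rewrite -setCI; apply: contra_not => -[/= cx ix] _ e e0.
have [z|N NP] := @fejer_op_cvg R d u x (fracv x) M uM ix _ cx e e0.
  exists (tnth (floorv x) z); rewrite -{1}(shift_fracv x) tnth_shift addrC.
  by rewrite [tnth (int_rvec _ _) _]tnth_mktuple.
exists N => m /NP lt.
by rewrite -mulrBr normcM normc_e1 mul1r.
Qed.

(** By dual_orth, averaging e1 (lam p . (x - s j - fracv x)) over p detects
    the cell of s j, since x - fracv x is the index of the cell of x. So the
    indicator of B is a combination of the functions e1 (x . lam p) * u (fracv x)
    with u y = e1 (- y . lam p) * (indicator of B at s j + y). *)
Lemma approximable_indic_locally_constant (B : set (rvec R d)) : measurable B ->
  {ae mu, forall x, forall z : d.-tuple int,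
    locally_constant B (shift (int_rvec R z) x)} ->
  V (fun x => (\1_B x : R)%:C).
Proof.
move=> mB lB.
pose u p j (y : rvec R d) : C := e1 (- dotp y (lam p)) * (\1_B (shift (S j) y) : R)%:C.
have n1 y : normc (\1_B y : R)%:C <= 1.
  by rewrite normc_real indicE; case: (_ \in _); rewrite ?normr1 ?normr0.
have Vu p j : V (fun x => e1 (dotp x (lam p)) * u p j (fracv x)).
  apply: (@approximable_fracv p (u p j) 1).
  - apply: cmeasM.
      apply: (cmeas_e1 (g := fun x => - dotp x (lam p))).
      exact: (measurable_funN (measurable_dotp (lam p) (D := setT))).
    exact: (@cmeas_shift _ _ (S j) (fun x => (\1_B x : R)%:C)
      (cmeas_indic setT mB)).
  - by move=> y; rewrite /u normcM normc_e1 mul1r.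
  apply: negligibleS lB => x; apply: contra_not => lx e e0.
  have [eta eta0 etaP] := @e1_dotp_continuous R d (lam p) (fracv x) e e0.
  have [eta' eta'0 etaP'] := lx [tuple tnth (s j) i - tnth (floorv x) i | i < d].
  exists (Num.min eta eta'); first by rewrite lt_min eta0.
  move=> y xy.
  have E : shift (S j) (fracv x) =
      shift (int_rvec R [tuple tnth (s j) i - tnth (floorv x) i | i < d]) x.
    apply/esym/eq_from_tnth => i; rewrite !tnth_shift tnth_oppv.
    rewrite ![tnth (int_rvec _ _) _]tnth_mktuple.
    by rewrite [tnth [tuple _ | _ < _] _]tnth_mktuple intrB addrA.
  have BE : \1_B (shift (S j) y) = \1_B (shift (S j) (fracv x)) :> R.
    have [BB BB'] : B (shift (S j) y) <-> B (shift (S j) (fracv x)).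
      rewrite E; apply: etaP' => i; rewrite -E.
      rewrite [tnth (shift (S j) (fracv x)) i]tnth_shift.
      rewrite [tnth (shift (S j) y) i]tnth_shift.
      rewrite opprD addrACA subrr add0r.
      by apply: lt_le_trans (xy i) _; rewrite ge_min lexx orbT.
    rewrite !indicE; congr ((_ : bool)%:R).
    by apply/idP/idP => /set_mem h; apply/mem_set; [exact: BB|exact: BB'].
  rewrite /u BE -mulrBl normcM -[ltRHS]mulr1.
  apply: (@le_lt_trans _ _
    (normc (e1 (- dotp y (lam p)) - e1 (- dotp (fracv x) (lam p))) * 1)).
    by rewrite ler_wpM2l ?normc_ge0.
  rewrite !mulr1; apply: etaP => i.
  by apply: lt_le_trans (xy i) _; rewrite ge_min lexx.
have Vsum : V (fun x => \sum_(p < k) \sum_(j < k)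
    (e1 (- dotp (S j) (lam p)) / k%:R) * (e1 (dotp x (lam p)) * u p j (fracv x))).
  apply: approximable_sum => // p; apply: approximable_sum => // j.
  exact: approximableZ.
have kC : k%:R != 0 :> C by rewrite pnatr_eq0 -lt0n.
apply: approximable_eq Vsum => x /set_mem /cube_union_floorv[i ix].
rewrite exchange_big /=.
transitivity (\sum_(j < k) (i == j)%:R * (\1_B (shift (S j) (fracv x)) : R)%:C).
  apply: eq_bigr => j _.
  rewrite (_ : (i == j)%:R = (k * (i == j))%:R / k%:R); last first.
    by rewrite natrM mulrC mulKf.
  rewrite -dual_orth !mulr_suml; apply: eq_bigr => p _.
  rewrite /u !mulrA; congr (_ * _).
  have -> : dotp x (lam p) = dotp (S i) (lam p) + dotp (fracv x) (lam p).
    by rewrite -dotp_shift ix shift_fracv.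
  rewrite -[LHS]mulrA -e1D mulrAC -e1D; congr (e1 _ / _); ring.
rewrite (bigD1 i) //= eqxx mul1r big1 ?addr0 ?ix ?shift_fracv //.
by move=> j ji; rewrite eq_sym (negbTE ji) mul0r.
Qed.

End density.

Section density.
Context (R : realType) (d k : nat).
Variables (s : 'I_k -> d.-tuple int) (lam : 'I_k -> rvec R d).
Local Notation C := R[i].
Local Notation S j := (int_rvec R (s j)).
Hypothesis k0 : (0 < k)%N.
Hypothesis orth : forall p q,
  \sum_(j < k) e1 (dotp (S j) (lam p) - dotp (S j) (lam q)) = (k * (p == q))%:R.
Let mu := lebesgue_measure_rvec R d.
Let Omega := cube_union R s.
Notation V := (approximable mu Omega (shifted_freqs lam) (normalized_exp Omega)).
Let mO : measurable Omega := measurable_cube_union s.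
Let mexp : forall i, shifted_freqs lam i -> cmeas Omega (normalized_exp Omega i).
Proof. by move=> i _; exact: (cmeas_normalized_exp k0 orth). Qed.

(** Orthants are locally constant off countably many hyperplanes. The sets with
    approximable indicator form a Dynkin system, and the orthants are a
    pi-system that generates the measurable sets. *)
Lemma approximable_indic A : measurable A -> V (fun x => (\1_A x : R)%:C).
Proof.
move=> mA.
have : <<s [set orthant a | a in [set: rvec R d]] >> A.
  by rewrite -tuple_measurableE.
move: A {mA}.
apply: (dynkin_induction (@tuple_measurableE R d) (@orthant_setI R d)).
- by apply: approximable_indic_locally_constant => //; exact: ae_locally_constantT.
- move=> _ [a _ <-]; apply: approximable_indic_locally_constant => //.
    exact: measurable_orthant.
  exact: ae_locally_constant_orthant.
- move=> A mA VA.
  have V1 : V (fun x => (\1_[set: rvec R d] x : R)%:C).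
    by apply: approximable_indic_locally_constant => //; exact: ae_locally_constantT.
  have VC := approximableD mO mexp V1 (approximableZ mO mexp (-1) VA).
  apply: approximable_eq VC => x _ /=.
  rewrite !indicE in_setT in_setC.
  by case: (x \in A); rewrite /= ?mulr1 ?mulr0 ?addr0 ?subrr //;
    apply/eqP; rewrite eq_complex /=; simpc.
move=> F mF tF VF.
apply: (@approximable_dominated _ _ _ mu Omega mO _ _ _ mexp
  (fun n x => \sum_(i < n) (\1_(F i) x : R)%:C) _ (cst 1)).
- by move=> n; apply: approximable_sum => // i; exact: VF.
- by apply: cmeas_indic; exact: bigcup_measurable.
- exact: integrable_cst_Omega.
- move=> n x _; rewrite -rmorph_sum normc_real real_normK ?num_real //.
  have : 0 <= \sum_(i < n) (\1_(F i) x : R) <= 1.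
    have [[i Fi]|nF] := pselect (exists i, F i x); last first.
      rewrite big1 ?lexx ?ler01 // => i _; rewrite indicE memNset //.
      by move=> Fi; apply: nF; exists i.
    rewrite sumr_ge0 //=.
    have [ni|ni] := leqP n i.
      rewrite big1 ?ler01 // => j _; rewrite indicE memNset // => Fj.
      have ij : j = i :> nat by apply: tF => //; exists x.
      by have := ltn_ord j; rewrite ij ltnNge ni.
    rewrite (bigD1 (Ordinal ni)) //= big1 ?addr0.
      by rewrite indicE; case: (_ \in _).
    move=> j ji; rewrite indicE memNset // => Fj.
    have ij : j = i :> nat by apply: tF => //; exists x.
    by move: ji; rewrite -val_eqE /= ij eqxx.
  by move=> /andP[? ?]; rewrite expr_le1.
- move=> x _; rewrite normc_real indicE.
  by case: (_ \in _); rewrite ?normr1 ?normr0 ?expr1n ?expr0n.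
apply: aeW => x _ e e0.
have [[i Fi]|nF] := pselect (exists i, F i x); last first.
  exists 0 => n _; rewrite big1; last first.
    move=> i _; rewrite indicE memNset //.
    by move=> Fi; apply: nF; exists i.
  rewrite indicE memNset ?subr0 ?normc0 //.
  by move=> [i _ Fi]; apply: nF; exists i.
exists i.+1 => n ni; rewrite (bigD1 (Ordinal ni)) //= big1; last first.
  move=> j ji; rewrite indicE memNset // => Fj.
  have ij : j = i :> nat by apply: tF => //; exists x.
  by move: ji; rewrite -val_eqE /= ij eqxx.
rewrite addr0 !indicE !mem_set ?subrr ?normc0 //.
by exists i.
Qed.

Lemma approximable_nonneg (g h : rvec R d -> R) : measurable_fun Omega g ->
  (forall x, Omega x -> 0 <= g x) -> mu.-integrable Omega (EFin \o h) ->
  (forall x, Omega x -> g x ^+ 2 <= h x) -> V (fun x => (g x)%:C).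
Proof.
move=> mg g0 ih gh.
have mg' : measurable_fun Omega (EFin \o g) by exact/measurable_EFinP.
have g0' x : Omega x -> (0 <= (EFin \o g) x)%E by move=> /g0; rewrite lee_fin.
have a0 n x : 0 <= approx Omega (EFin \o g) n x.
  rewrite /approx; apply: addr_ge0; last exact: mulr_ge0.
  by apply: sumr_ge0 => i _; rewrite !mulr_ge0 // invr_ge0 exprn_ge0.
have ag n x : Omega x -> approx Omega (EFin \o g) n x <= g x.
  by move=> Ox; rewrite -lee_fin; exact: (le_approx n g0' Ox).
apply: (@approximable_dominated _ _ _ mu Omega mO _ _ _ mexp
  (fun n x => (approx Omega (EFin \o g) n x)%:C) _ h) => //.
- move=> n.
  have mA i : measurable (dyadic_approx Omega (EFin \o g) n i).
    rewrite /dyadic_approx; case: ifPn => // _; rewrite -preimage_comp.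
    by apply: mg' => //; apply/measurable_image_EFin; exact: measurable_itv.
  have mB : measurable (integer_approx Omega (EFin \o g) n).
    by apply: emeasurable_fun_c_infty => //.
  have VA : V (fun x => \sum_(i < n * 2 ^ n) (i%:R * 2 ^- n : R)%:C *
      (\1_(dyadic_approx Omega (EFin \o g) n i) x : R)%:C).
    apply: approximable_sum => // i; apply: approximableZ => //.
    exact: approximable_indic.
  have VB := approximableZ mO mexp (n%:R : R)%:C (approximable_indic mB).
  apply: approximable_eq (approximableD mO mexp VA VB) => x _.
  rewrite /approx rmorphD rmorph_sum /= rmorphM /=; congr (_ + _).
  by apply: eq_bigr => i _; rewrite [RHS]rmorphM.
- move=> n x Ox; rewrite normc_real ger0_norm ?a0 //.
  apply: le_trans (gh x Ox); rewrite lerXn2r ?nnegrE ?a0 ?g0 //; exact: ag.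
- by move=> x Ox; rewrite normc_real ger0_norm ?g0 //; exact: gh.
apply: aeW => x Ox e e0.
have := @cvg_approx _ _ _ Omega (EFin \o g) x g0' Ox (ltry (g x)).
move=> /cvgrPdist_lt /(_ _ e0) [N _ NP]; exists N => n Nn.
rewrite -rmorphB normc_real distrC; exact: NP.
Qed.

Lemma L2_approximable f : in_L2 mu Omega f -> V f.
Proof.
move=> [mr mi foo].
pose h x := normc (f x) ^+ 2.
have ih : mu.-integrable Omega (EFin \o h).
  apply/integrableP; split; first exact: (measurable_normc_sqr (conj mr mi)).
  rewrite (eq_integral (fun x => (normc (f x) ^+ 2)%:E)) //.
  by move=> x _ /=; rewrite ger0_norm // sqr_ge0.
have Vpos (g : rvec R d -> R) : measurable_fun Omega g ->
    (forall x, g x ^+ 2 <= h x) -> V (fun x => (Num.max (g x) 0)%:C).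
  move=> mg gh; apply: (approximable_nonneg (h := h)) => //.
  - by apply: measurable_maxr => //; exact: measurable_cst.
  - by move=> x _; rewrite le_max lexx orbT.
  - move=> x _; apply: le_trans (gh x); rewrite maxEle.
    by case: ifP; rewrite ?lexx // expr0n /= sqr_ge0.
have Re_le x : complex.Re (f x) ^+ 2 <= h x by rewrite /h normc_sqr lerDl sqr_ge0.
have Im_le x : complex.Im (f x) ^+ 2 <= h x by rewrite /h normc_sqr lerDr sqr_ge0.
have V1 := Vpos _ mr Re_le.
have V3 := Vpos _ mi Im_le.
have V2 : V (fun x => (Num.max (- complex.Re (f x)) 0)%:C).
  by apply: Vpos; [exact: measurable_funN|move=> x; rewrite sqrrN].
have V4 : V (fun x => (Num.max (- complex.Im (f x)) 0)%:C).
  by apply: Vpos; [exact: measurable_funN|move=> x; rewrite sqrrN].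
have Vr := approximableD mO mexp V1 (approximableZ mO mexp (-1) V2).
have Vi := approximableD mO mexp V3 (approximableZ mO mexp (-1) V4).
have Vf := approximableD mO mexp Vr (approximableZ mO mexp 'i Vi).
apply: approximable_eq Vf => x _ /=.
have posneg (a : R) : Num.max a 0 - Num.max (- a) 0 = a.
  by rewrite !maxEle; case: (lerP a 0) => a1; case: (lerP (- a) 0) => a2; lra.
rewrite !mulN1r -!rmorphB /= !posneg.
by rewrite -complexE.
Qed.

End density.

(** * Integrals of characters *)

Section character_integral.
Context (R : realType) (d : nat).
Local Notation C := R[i].
Let mu := lebesgue_measure_rvec R d.

Definition char_int (D : set (rvec R d)) (zeta : rvec R d) : C :=
  cintegral mu D (fun x => e1 (dotp x zeta)).

Lemma integrable_bounded1 (f : rvec R d -> R) D :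
  measurable D -> (mu D < +oo)%E ->
  measurable_fun setT f -> (forall x, `|f x| <= 1) ->
  mu.-integrable D (EFin \o f).
Proof.
move=> mD Doo mf f1; apply: (@le_integrable _ _ _ mu D mD _ (cst 1%E)).
- by apply/measurable_EFinP; apply: measurable_funTS.
- by move=> x _; rewrite /= lee_fin normr1.
apply/integrableP; split; first exact: measurable_cst.
rewrite (eq_integral (cst 1%E)); last by move=> x _; rewrite /= normr1.
by rewrite (@lebesgue_integral_nonneg.integral_cst _ _ _ mu D mD) mul1e.
Qed.

Lemma measurable_cos_dotp (zeta : rvec R d) :
  measurable_fun setT (fun x : rvec R d => cos (2 * pi * dotp x zeta)).
Proof.
have [mc _] := cmeas_e1 (measurable_dotp zeta (D := setT)).
exact: mc.
Qed.

Lemma measurable_sin_dotp (zeta : rvec R d) :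
  measurable_fun setT (fun x : rvec R d => sin (2 * pi * dotp x zeta)).
Proof.
have [_ ms] := cmeas_e1 (measurable_dotp zeta (D := setT)).
exact: ms.
Qed.

Lemma normr_cos_le1 (t : R) : `|cos t| <= 1.
Proof. by rewrite ler_norml cos_geN1 cos_le1. Qed.

Lemma normr_sin_le1 (t : R) : `|sin t| <= 1.
Proof. by rewrite ler_norml sin_geN1 sin_le1. Qed.

Lemma integrable_cos (zeta : rvec R d) D : measurable D -> (mu D < +oo)%E ->
  mu.-integrable D (EFin \o (fun x => cos (2 * pi * dotp x zeta))).
Proof.
move=> mD Doo; apply: integrable_bounded1 => //.
  exact: measurable_cos_dotp.
by move=> x; exact: normr_cos_le1.
Qed.

Lemma integrable_sin (zeta : rvec R d) D : measurable D -> (mu D < +oo)%E ->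
  mu.-integrable D (EFin \o (fun x => sin (2 * pi * dotp x zeta))).
Proof.
move=> mD Doo; apply: integrable_bounded1 => //.
  exact: measurable_sin_dotp.
by move=> x; exact: normr_sin_le1.
Qed.

Lemma cintegral_char (a : C) D zeta : measurable D -> (mu D < +oo)%E ->
  cintegral mu D (fun x => a * e1 (dotp x zeta)) = a * char_int D zeta.
Proof.
move=> mD Doo.
have ic := integrable_cos zeta mD Doo; have is_ := integrable_sin zeta mD Doo.
rewrite /char_int /cintegral; case: a => a b; rewrite /e1 /expi /=.
have iZ (c : R) f : mu.-integrable D (EFin \o f) ->
    mu.-integrable D (EFin \o (fun x : rvec R d => c * f x)).
  by move=> fi; have := integrableZl mD c fi.
simpc; congr (_ +i* _).
  by rewrite RintegralB ?RintegralZl //; exact: iZ.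
by rewrite RintegralD ?RintegralZl //; exact: iZ.
Qed.

Lemma char_int_setU A B zeta : measurable A -> measurable B ->
  (mu A < +oo)%E -> (mu B < +oo)%E -> [disjoint A & B] ->
  char_int (A `|` B) zeta = char_int A zeta + char_int B zeta.
Proof.
move=> mA mB Aoo Boo AB.
have mAB : measurable (A `|` B) by exact: measurableU.
have ABoo : (mu (A `|` B) < +oo)%E.
  apply: (@le_lt_trans _ _ (mu A + mu B)%E); first exact: measureU2.
  exact: lte_add_pinfty.
rewrite /char_int /cintegral /=; simpc; congr (_ +i* _).
  by rewrite Rintegral_setU //; exact: integrable_cos.
by rewrite Rintegral_setU //; exact: integrable_sin.
Qed.

Lemma Rintegral_preshift (v : rvec R d) (D : set (rvec R d))
    (f : rvec R d -> R) : measurable D -> (mu D < +oo)%E -> measurable_fun setT f -> (forall x, `|f x| <= 1) ->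
  (\int[mu]_(x in D) f x)%R = (\int[mu]_(x in shift v @^-1` D) f (shift v x))%R.
Proof.
move=> mD Doo mf f1; rewrite /Rintegral; congr fine.
have mvD : measurable (shift v @^-1` D) by exact: measurable_preshift.
have mvoo : (mu (shift v @^-1` D) < +oo)%E by rewrite /mu rvec_measure_preshift.
rewrite -[RHS](@integral_pushforward _ _ _ _ R (shift v) (measurable_shift v) mu
  D (EFin \o f)) //.
- apply: eq_measure_integral => [|mshift A mA _]; first exact: measurable_shift.
  exact: (esym (rvec_measure_preshift v mA)).
- exact/measurable_EFinP.
- apply: (@integrable_bounded1 (fun x => f (shift v x))) => //.
  exact: (measurableT_comp mf (measurable_shift v)).
Qed.

Lemma char_int_preshift v D zeta : measurable D -> (mu D < +oo)%E ->
  char_int D zeta = e1 (dotp v zeta) * char_int (shift v @^-1` D) zeta.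
Proof.
move=> mD Doo; rewrite -cintegral_char; first last.
- by rewrite /mu rvec_measure_preshift.
- exact: measurable_preshift.
rewrite /char_int /cintegral; congr (_ +i* _).
  rewrite (Rintegral_preshift v) //.
  - by apply: eq_Rintegral => x _; rewrite dotp_shift e1D.
  - exact: measurable_cos_dotp.
  - by move=> x; exact: normr_cos_le1.
rewrite (Rintegral_preshift v) //.
- by apply: eq_Rintegral => x _; rewrite dotp_shift e1D.
- exact: measurable_sin_dotp.
- by move=> x; exact: normr_sin_le1.
Qed.

End character_integral.

(** * Spectra of unions of cubes *)

Section unit_cube_integral.
Context (R : realType) (d : nat).
Local Notation C := R[i].
Let mu := lebesgue_measure_rvec R d.
Let Q := unit_cube R d.

Lemma measurable_unit_cube : measurable Q.
Proof. exact: measurable_hcube. Qed.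

Lemma measure_unit_cube : mu Q = 1%E.
Proof. by rewrite /mu /Q unit_cubeE measure_hcube // subr0 expr1n. Qed.

Lemma measurable_coord (i : 'I_d) (I : interval R) :
  measurable [set x : rvec R d | (tnth x i : R) \in I].
Proof.
rewrite (_ : [set x | _] = (fun x => tnth x i) @^-1` [set` I]) //.
rewrite -[X in measurable X]setTI.
by apply: measurable_tnth => //; exact: measurable_itv.
Qed.

(** The cyclic shift of the cube by t = 1 / (2 |m_i|) in direction i preserves
    measure and multiplies the character by e1 (+- 1 / 2) = -1, so the integral
    is its own opposite. The cyclic shift translates the part of the cube above
    the hyperplane x_i = 1 - t by t - 1, and the part below it by t. *)
Lemma char_int_unit_cube (m : d.-tuple int) (i : 'I_d) : tnth m i != 0 ->
  char_int Q (int_rvec R m) = 0.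
Proof.
move=> mi; set zeta := int_rvec R m.
pose c : R := `|tnth m i|%:~R.
have c1 : 1 <= c by rewrite /c (_ : 1 = 1%:~R) // ler_int; lia.
pose t : R := 1 / (2 * c).
have t0 : 0 < t by rewrite divr_gt0 // mulr_gt0 //; lra.
have t1 : t <= 1 / 2.
  by rewrite /t ler_pdivrMr ?mulr_gt0 //; lra.
pose v (a : R) : rvec R d := [tuple if l == i then a else 0 | l < d].
have dv a : dotp (v a) zeta = a * (tnth m i)%:~R.
  rewrite /dotp (bigD1 i) //= big1 ?addr0 ?tnth_mktuple ?eqxx //.
  by move=> l li; rewrite tnth_mktuple (negbTE li) mul0r.
have et : e1 (t * (tnth m i)%:~R) = -1.
  have tc : t * c = 1 / 2 by rewrite /t; field; lra.
  have : tnth m i = `|tnth m i| \/ tnth m i = - `|tnth m i| by lia.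
  case=> ->; first by rewrite tc e1_half.
  rewrite mulrNz mulrN tc e1N e1_half.
  by apply/eqP; rewrite eq_complex /= !oppr0 !eqxx.
have et' : e1 ((t - 1) * (tnth m i)%:~R) = -1.
  by rewrite mulrBl mul1r e1D et -mulrNz e1_int mulr1.
pose lo (a : R) : set (rvec R d) :=
  Q `&` [set x | (tnth x i : R) \in `]-oo, a[].
pose hi (a : R) : set (rvec R d) :=
  Q `&` [set x | (tnth x i : R) \in `[a, +oo[].
have mlo a : measurable (lo a).
  by apply: measurableI; [exact: measurable_unit_cube|exact: measurable_coord].
have mhi a : measurable (hi a).
  by apply: measurableI; [exact: measurable_unit_cube|exact: measurable_coord].
have Qoo : (mu Q < +oo)%E by rewrite measure_unit_cube ltry.
have fin A : measurable A -> A `<=` Q -> (mu A < +oo)%E.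
  move=> mA AQ; apply: le_lt_trans Qoo.
  by apply: le_measure; rewrite ?inE //; exact: measurable_unit_cube.
have flo a : (mu (lo a) < +oo)%E by apply: fin => // x [].
have fhi a : (mu (hi a) < +oo)%E by apply: fin => // x [].
have QE a : Q = lo a `|` hi a.
  apply/seteqP; split=> x; last by case=> -[].
  move=> Qx; have [xa|xa] := ltP (tnth x i : R) a; [left|right]; split => //.
  by rewrite /= in_itv /= xa.
have disj a : [disjoint lo a & hi a].
  apply/disj_setPS => x [[_ /=] + [_ /=]]; rewrite !in_itv /= andbT; lra.
have JQ a : char_int Q zeta = char_int (lo a) zeta + char_int (hi a) zeta.
  by rewrite [in LHS](QE a); apply: char_int_setU.
have Qv a x : 0 <= (tnth x i : R) < 1 -> 0 <= a + (tnth x i : R) < 1 ->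
    Q (shift (v a) x) <-> Q x.
  move=> xi xia; split=> Qx l; have := Qx l; rewrite tnth_shift tnth_mktuple;
    by case: eqP => [->|_]; rewrite ?add0r.
have xv a x : tnth (shift (v a) x) i = a + (tnth x i : R).
  by rewrite tnth_shift tnth_mktuple eqxx.
have shi : shift (v t) @^-1` hi t = lo (1 - t).
  apply/seteqP; split=> x; rewrite /hi /lo /= !in_itv /= andbT xv => -[Qx xt].
    have := Qx i; rewrite xv => xi; have xi' : 0 <= (tnth x i : R) < 1 by lra.
    by split; [exact/(Qv t x xi' xi)|lra].
  have xi := Qx i; have xi' : 0 <= t + (tnth x i : R) < 1 by lra.
  by split; [exact/(Qv t x xi xi')|lra].
have slo : shift (v (t - 1)) @^-1` lo t = hi (1 - t).
  apply/seteqP; split=> x; rewrite /hi /lo /= !in_itv /= andbT xv => -[Qx xt].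
    have := Qx i; rewrite xv => xi; have xi' : 0 <= (tnth x i : R) < 1 by lra.
    by split; [exact/(Qv (t - 1) x xi' xi)|lra].
  have xi := Qx i; have xi' : 0 <= (t - 1) + (tnth x i : R) < 1 by lra.
  by split; [exact/(Qv (t - 1) x xi xi')|lra].
have : char_int Q zeta = - char_int Q zeta.
  rewrite [LHS](JQ t) [in RHS](JQ (1 - t)).
  rewrite (char_int_preshift (v t) zeta (mhi t)) // shi dv et.
  rewrite (char_int_preshift (v (t - 1)) zeta (mlo t)) // slo dv et'.
  by rewrite !mulN1r opprD addrC.
by move/eqP; rewrite -subr_eq0 opprK -mulr2n mulrn_eq0 /= => /eqP.
Qed.

End unit_cube_integral.

Section spectrum.
Context (R : realType) (d k : nat).
Variables (s : 'I_k -> d.-tuple int) (lam : 'I_k -> rvec R d).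
Local Notation C := R[i].
Local Notation S j := (int_rvec R (s j)).
Hypothesis k0 : (0 < k)%N.
Hypothesis orth : forall p q,
  \sum_(j < k) e1 (dotp (S j) (lam p) - dotp (S j) (lam q)) = (k * (p == q))%:R.
Let mu := lebesgue_measure_rvec R d.
Let Omega := cube_union R s.
Let Q := unit_cube R d.

Lemma char_int_cube_union zeta :
  char_int Omega zeta = (\sum_(j < k) e1 (dotp (S j) zeta)) * char_int Q zeta.
Proof.
pose cell j := translate (S j) Q.
have mc j : measurable (cell j) by exact: measurable_translate_cube.
have cell1 j : mu (cell j) = 1%E by exact: measure_translate_cube.
have one j : char_int (cell j) zeta = e1 (dotp (S j) zeta) * char_int Q zeta.
  rewrite (char_int_preshift (S j)) ?[X in (X < _)%E]cell1 ?ltry //.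
  congr (_ * char_int _ _).
  rewrite /cell translateE -comp_preimage (_ : _ \o _ = id) ?preimage_id //.
  by apply/funext => x /=; exact: shiftNK.
have inj := orth_inj k0 orth.
have gen (r : seq 'I_k) : uniq r ->
    [/\ measurable (\bigcup_(j in [set` r]) cell j),
        (mu (\bigcup_(j in [set` r]) cell j) < +oo)%E &
        char_int (\bigcup_(j in [set` r]) cell j) zeta =
        \sum_(j <- r) char_int (cell j) zeta].
  elim: r => [_|j r IH /= /andP[jr ur]].
    rewrite bigcup_seq !big_nil measure0; split=> //.
    by rewrite /char_int /cintegral !Rintegral_set0.
  have [mr roo E] := IH ur.
  rewrite bigcup_seq_cons big_cons -E.
  have j1 : (mu (cell j) < +oo)%E by rewrite cell1 ltry.
  split; first exact: measurableU.
    apply: (@le_lt_trans _ _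
      (mu (cell j) + mu (\bigcup_(j in [set` r]) cell j))%E).
      exact: measureU2.
    exact: lte_add_pinfty.
  apply: char_int_setU => //.
  apply/disj_setPS => x [+ [l lr]].
  rewrite /cell !translate_cubeE /= => -> /inj jl.
  by move: jr; rewrite jl lr.
have [_ _] := gen _ (enum_uniq 'I_k).
rewrite -cube_union_seq => ->; rewrite big_enum mulr_suml /=.
by apply: eq_bigr => j _; exact: one.
Qed.

(** For two frequencies in different classes p, q modulo Z^d the sum over the
    cells vanishes, by orth; for different frequencies in the same class the
    integral over the unit cube vanishes. *)
Lemma spectrum_orthonormal xi eta : shifted_freqs lam xi -> shifted_freqs lam eta ->
  inner mu Omega (normalized_exp Omega xi) (normalized_exp Omega eta) =
  (xi == eta)%:R.
Proof.
move=> [p [m xiE]] [q [n etaE]].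
have kC : k%:R != 0 :> C by rewrite pnatr_eq0 -lt0n.
pose zeta := shift (oppv eta) xi.
have dz x : dotp x zeta = dotp x xi - dotp x eta.
  rewrite /zeta dotp_shiftr addrC; congr (_ + _).
  by rewrite /dotp -sumrN; apply: eq_bigr => i _; rewrite tnth_oppv mulrN.
have -> : inner mu Omega (normalized_exp Omega xi) (normalized_exp Omega eta) =
    k%:R^-1 * char_int Omega zeta.
  rewrite -cintegral_char; last first.
  - by rewrite /Omega (measure_orth_union k0 orth) ltry.
  - exact: measurable_cube_union.
  rewrite /inner; congr cintegral; apply/funext => x.
  have cc : ((Num.sqrt k%:R : R)^-1)%:C * ((Num.sqrt k%:R : R)^-1)%:C = k%:R^-1.
    by rewrite -rmorphM -invfM -expr2 sqr_sqrtr // fmorphV rmorph_nat.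
  have conjM (a b : C) : conjc (a * b) = conjc a * conjc b :> C by exact: rmorphM.
  have conjR (a : R) : conjc a%:C = a%:C by exact: conjc_real.
  rewrite !(normalized_expE k0 orth) conjM conjR -e1N.
  by rewrite mulrACA cc -e1D dz.
rewrite char_int_cube_union.
have -> : \sum_(j < k) e1 (dotp (S j) zeta) = (k * (p == q))%:R.
  rewrite -orth; apply: eq_bigr => j _.
  rewrite dz xiE etaE !dotp_shiftr.
  have [a ->] := dotp_int R (s j) m; have [b ->] := dotp_int R (s j) n.
  transitivity (e1 ((a - b)%:~R + (dotp (S j) (lam p) - dotp (S j) (lam q)))).
    by congr e1; rewrite intrB; ring.
  by rewrite [LHS]e1D e1_int mul1r.
have [pq|] := eqVneq p q; last first.
  move=> pq; rewrite muln0 mul0r mulr0; case: eqP => // xe.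
  (* if two classes of frequencies modulo Z^d coincide, then orth p q is a sum
     of k ones and cannot vanish *)
  have := orth p q; rewrite (negbTE pq) muln0.
  rewrite (eq_bigr (fun=> 1)); last first.
    move=> j _.
    have : dotp (S j) xi = dotp (S j) eta by rewrite xe.
    rewrite xiE etaE !dotp_shiftr.
    have [a ->] := dotp_int R (s j) m; have [b ->] := dotp_int R (s j) n.
    move=> ab; rewrite (_ : _ - _ = (b - a)%:~R) ?e1_int //.
    by rewrite intrB; lra.
  by rewrite sumr_const card_ord => /eqP; rewrite (negbTE kC).
rewrite muln1 mulrA mulVf // mul1r.
have zE i : tnth zeta i = (tnth m i - tnth n i)%:~R :> R.
  rewrite /zeta xiE etaE pq tnth_shift tnth_oppv !tnth_shift.
  by rewrite ![tnth (int_rvec _ _) _]tnth_mktuple intrB; lra.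
have zI : zeta = int_rvec R [tuple tnth m i - tnth n i | i < d].
  by apply: eq_from_tnth => i; rewrite zE !tnth_mktuple.
have [xe|xe] := eqVneq xi eta.
  have z0 x : dotp x zeta = 0 by rewrite dz xe subrr.
  rewrite /char_int /cintegral.
  rewrite (_ : (\int[_]_(x in Q) _)%R = 1); last first.
    rewrite (@eq_Rintegral _ _ _ _ _ (cst 1)); last by move=> x _; rewrite z0 e10.
    by rewrite Rintegral_cst ?mul1r; [rewrite [X in fine X]measure_unit_cube|exact: measurable_unit_cube].
  rewrite (_ : (\int[_]_(x in Q) _)%R = 0) //.
  rewrite (@eq_Rintegral _ _ _ _ _ (cst 0)); last by move=> x _; rewrite z0 e10.
  by rewrite Rintegral_cst ?mul0r //; exact: measurable_unit_cube.
have [i mi] : exists i, tnth m i - tnth n i != 0.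
  apply: contrapT => nz; move/eqP: xe; apply.
  rewrite xiE etaE pq; congr shift; congr int_rvec; apply: eq_from_tnth => i.
  apply/eqP; rewrite -subr_eq0; apply/negPn/negP => h; apply: nz; by exists i.
rewrite zI; apply: (@char_int_unit_cube R d _ i).
by rewrite tnth_mktuple.
Qed.

(** The spectrum consists of the frequencies lam p + m with m in Z^d: the integer
    vectors m resolve functions inside of a unit cube, and the k frequencies
    lam p resolve the k cubes. *)
Theorem spectral_cube_union : spectral Omega.
Proof.
exists (shifted_freqs lam); split.
- move=> xi _; have [mr mi] := cmeas_normalized_exp k0 orth xi Omega; split=> //.
  rewrite /sqr_norm2 (eq_integral (cst (normc ((Num.sqrt k%:R : R)^-1)%:C ^+ 2)%:E)).
    rewrite (@lebesgue_integral_nonneg.integral_cst _ _ _ mu Omega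
      (measurable_cube_union s)).
    by rewrite [X in (_ * X)%E](measure_orth_union k0 orth) -EFinM ltry.
  by move=> x _; rewrite (normalized_expE k0 orth) normcM normc_e1 mulr1.
- exact: spectrum_orthonormal.
- by move=> f /(L2_approximable k0 orth)[_].
Qed.

End spectrum.

(** * Six nodes in dimension four *)

Section hadamard.

(** The 6 x 6 matrix of the inner products of nodes and frequencies modulo 3 is
    the logarithm of a complex Hadamard matrix whose entries are cube roots of
    unity. It has rank 4 over the field with three elements, which is why both
    families can be chosen in dimension 4. *)
Definition node_table : seq (seq nat) :=
  [:: [:: 0; 0; 0; 0]; [:: 1; 0; 0; 0]; [:: 0; 1; 0; 0];
      [:: 0; 0; 1; 0]; [:: 0; 0; 0; 1]; [:: 2; 2; 2; 2]]%N.

Definition freq_table : seq (seq nat) :=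
  [:: [:: 0; 0; 0; 0]; [:: 0; 1; 1; 2]; [:: 1; 0; 2; 2];
      [:: 1; 2; 0; 1]; [:: 2; 2; 1; 0]; [:: 2; 1; 2; 1]]%N.

Definition node (a i : nat) : nat := nth 0%N (nth [::] node_table a) i.
Definition freq (b i : nat) : nat := nth 0%N (nth [::] freq_table b) i.

Lemma node_lt3 a i : (node a i < 3)%N.
Proof.
have /allP h : all (all (fun x => x < 3)%N) node_table by [].
rewrite /node; have [a6|a6] := ltnP a (size node_table); last first.
  by rewrite (nth_default _ a6) nth_nil.
have /allP hr := h _ (mem_nth [::] a6).
have [i4|i4] := ltnP i (size (nth [::] node_table a)).
  exact: hr (mem_nth 0%N i4).
by rewrite nth_default.
Qed.

Lemma node_ge4 a i : (4 <= i)%N -> node a i = 0%N.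
Proof.
have /allP h : all (fun r => size r <= 4)%N node_table by [].
move=> i4; rewrite /node; have [a6|a6] := ltnP a (size node_table); last first.
  by rewrite (nth_default _ a6) nth_nil.
by apply: nth_default; apply: leq_trans i4; apply: h; exact: mem_nth.
Qed.

(** A natural number congruent modulo 3 to the inner product of node a with
    freq b - freq c; the factor 2 stands for -1. *)
Definition phase (a b c : nat) : nat :=
  (\sum_(i < 4) node a i * (freq b i + 2 * freq c i))%N.

(** A finite verification, which expresses that the rows of the Hadamard matrix
    are orthogonal, because the three cube roots of unity have sum 0. *)
Lemma phase_balanced (b c : nat) : (b < 6)%N -> (c < 6)%N -> b != c ->
  perm_eq [seq (phase a b c %% 3)%N | a <- iota 0 6] [:: 0; 0; 1; 1; 2; 2]%N.
Proof.
(* big operators do not compute, so the sum is expanded before evaluation *)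
pose ph a b c := (node a 0 * (freq b 0 + 2 * freq c 0) +
  (node a 1 * (freq b 1 + 2 * freq c 1) +
  (node a 2 * (freq b 2 + 2 * freq c 2) +
   (node a 3 * (freq b 3 + 2 * freq c 3)))))%N.
have phE a e f : phase a e f = ph a e f.
  by rewrite /phase !big_ord_recl big_ord0 /= addn0.
under eq_map do rewrite phE.
have /allP h : all (fun b => all (fun c => (b != c) ==>
   perm_eq [seq (ph a b c %% 3)%N | a <- iota 0 6] [:: 0; 0; 1; 1; 2; 2]%N)
   (iota 0 6)) (iota 0 6) by vm_compute.
move=> b6 c6 bc.
have b7 : b \in iota 0 6 by rewrite mem_iota.
have c7 : c \in iota 0 6 by rewrite mem_iota.
by have /allP /(_ _ c7) /implyP := h _ b7; apply.
Qed.

Variables (R : realType).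
Local Notation C := R[i].

(** Unless b = c, the six terms are the three cube roots of unity, each one
    twice. *)
Lemma sum_node_freq (d b c : nat) : (4 <= d)%N -> (b < 6)%N -> (c < 6)%N ->
  \sum_(a < 6) e1 (\sum_(i < d)
      (node a i)%:R * (((freq b i)%:R - (freq c i)%:R) / 3) : R) = (6 * (b == c))%:R.
Proof.
move=> d4 b6 c6.
have [->|bc] := eqVneq b c.
  rewrite (eq_bigr (fun=> 1)) ?sumr_const ?card_ord // => a _.
  by rewrite big1 ?e10 // => i _; rewrite subrr mul0r mulr0.
rewrite muln0.
have E (a : nat) : e1 (\sum_(i < d)
      (node a i)%:R * (((freq b i)%:R - (freq c i)%:R) / 3) : R) = e1 ((phase a b c %% 3)%:R / 3).
  have -> : \sum_(i < d) (node a i)%:R * (((freq b i)%:R - (freq c i)%:R) / 3) =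
    (phase a b c %% 3)%:R / 3 + ((phase a b c %/ 3)%:Z -
       (\sum_(i < d) node a i * freq c i)%N%:Z)%:~R :> R.
    pose F i := (node a i * (freq b i + 2 * freq c i))%N.
    have phd : phase a b c = (\sum_(i < d) F i)%N.
      rewrite /phase -(big_mkord xpredT F) -(big_mkord xpredT F).
      rewrite [RHS](big_cat_nat (n := 4)) //= [X in (_ + X)%N]big_nat_cond.
      rewrite [X in (_ + X)%N]big1 ?addn0 // => i /andP[/andP[i4 _] _].
      by rewrite /F node_ge4.
    rewrite intrB -!pmulrn.
    have dv : (phase a b c)%:R =
        (phase a b c %/ 3)%:R * 3 + (phase a b c %% 3)%:R :> R.
      by rewrite {1}(divn_eq (phase a b c) 3) natrD natrM.
    have : (phase a b c)%:R / 3 = \sum_(i < d)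
       (node a i)%:R * (((freq b i)%:R - (freq c i)%:R) / 3) +
       (\sum_(i < d) node a i * freq c i)%N%:R :> R.
      rewrite phd !natr_sum mulr_suml -big_split; apply: eq_bigr => i _ /=.
      by rewrite /F !natrM natrD natrM; field.
    by rewrite dv; lra.
  by rewrite e1D e1_int mulr1.
under eq_bigr do rewrite E.
rewrite -(big_mkord xpredT (fun a => e1 ((phase a b c %% 3)%:R / 3 : R))).
rewrite -(big_map (fun a => phase a b c %% 3)%N xpredT (fun x => e1 (x%:R / 3 : R))).
rewrite (perm_big _ (phase_balanced b6 c6 bc)) /=.
have := @sum_e1_frac R 3 1 isT.
rewrite !big_ord_recl big_ord0 !big_cons big_nil /= muln0 !addr0.
rewrite /bump /= mulr0 !(mul1r, mulr1) mul0r addn0 addn1 e10 => z.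
rewrite -[RHS](addr0 0) -[X in _ = X + _]z -[X in _ = _ + X]z [3^-1 * _]mulrC.
by ring.
Qed.

End hadamard.

(** * The counterexample *)

Section example.
Variables (R : realType) (d N : nat).
Hypothesis d4 : (4 <= d)%N.
Local Notation n := N.+1.
Local Notation C := R[i].
Local Notation idx := ('I_6 * {ffun 'I_d -> 'I_n})%type.

Definition point (x : idx) : d.-tuple int :=
  [tuple (node x.1 i + 3 * x.2 i)%:Z | i < d].

Definition frequency (y : idx) : rvec R d :=
  [tuple (freq y.1 i)%:R / 3 + (y.2 i : nat)%:R / (3 * n)%:R | i < d].

Lemma sum_torus_char (r r' : {ffun 'I_d -> 'I_n}) :
  \sum_(m : {ffun 'I_d -> 'I_n})
    \prod_i
      e1 (((r i : nat)%:Z - (r' i : nat)%:Z)%:~R / n%:R * (m i : nat)%:R : R)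
  = (n ^ d * (r == r'))%:R.
Proof.
rewrite -(bigA_distr_bigA (fun i (j : 'I_n) =>
  e1 (((r i : nat)%:Z - (r' i : nat)%:Z)%:~R / n%:R * (j : nat)%:R : R))).
rewrite (eq_bigr (fun i => (n * (r i == r' i))%:R)); last first.
  move=> i _; rewrite sum_e1_frac; last first.
    by have := ltn_ord (r i); have := ltn_ord (r' i); lia.
  by rewrite subr_eq0 eqz_nat val_eqE.
have [->|rr'] := eqVneq r r'.
  rewrite (eq_bigr (fun=> n%:R)); last by move=> i _; rewrite eqxx muln1.
  by rewrite prodr_const card_ord muln1 natrX.
have [i ri] : exists i, r i != r' i.
  apply: contrapT => nx; move/eqP: rr'; apply; apply/ffunP => i; apply/eqP.
  by apply/negPn/negP => h; apply: nx; exists i.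
by rewrite (bigD1 i) //= (negbTE ri) !muln0 mul0r.
Qed.

(** The inner product of a point and a difference of frequencies splits, up to
    an integer, into a part that depends only on the multiple of 3 in the point
    and a part that depends only on the node. The sum over the multiples of 3
    vanishes unless r = r'; then the second part reduces to sum_node_freq. *)
Lemma point_frequency_orth (y z : idx) :
  \sum_(x : idx) e1 (dotp (int_rvec R (point x)) (frequency y) -
                     dotp (int_rvec R (point x)) (frequency z)) =
  (6 * n ^ d * (y == z))%:R :> C.
Proof.
case: y z => [b r] [c r'].
pose E (a : nat) : C := e1 (\sum_(i < d) (node a i)%:R *
  (((freq b i)%:R - (freq c i)%:R) / 3 +
   ((r i : nat)%:R - (r' i : nat)%:R) / (3 * n)%:R)).
pose P (m : {ffun 'I_d -> 'I_n}) : C :=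
  \prod_i e1 (((r i : nat)%:Z - (r' i : nat)%:Z)%:~R / n%:R * (m i : nat)%:R : R).
have n0 : n%:R != 0 :> R by rewrite pnatr_eq0.
rewrite (eq_bigr (fun x : idx => E x.1 * P x.2)); last first.
  move=> [a m] _; rewrite /E /P -e1_sum -e1D /=.
  pose z : int := \sum_(i < d) (m i : nat)%:Z * ((freq b i)%:Z - (freq c i)%:Z).
  rewrite -[RHS]mulr1 -(e1_int R z) -e1D; congr e1.
  rewrite /dotp -sumrB -big_split /= /z rmorph_sum -big_split /=.
  apply: eq_bigr => i _.
  rewrite !tnth_mktuple -!pmulrn natrD !natrM rmorphM /= !intrB -!pmulrn.
  by field; rewrite nat1r.
rewrite -(pair_bigA _ (fun a m => E (a : 'I_6) * P m)) /=.
under eq_bigr do rewrite -mulr_sumr.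
rewrite -mulr_suml sum_torus_char xpair_eqE.
rewrite /E; have [->|rr'] := eqVneq r r'; last by rewrite andbF !muln0 mulr0.
rewrite andbT muln1.
under eq_bigr => a _.
  under eq_bigr do rewrite subrr mul0r addr0.
  over.
by rewrite sum_node_freq // -natrM mulnAC.
Qed.

Definition residues : {set {ffun 'I_d -> 'Z_3}} :=
  [set [ffun i : 'I_d => (node a i)%:R : 'Z_3] | a : 'I_6].

Lemma fat_set_point (v : d.-tuple int) :
  (exists x, point x = v) <-> fat_set n residues v.
Proof.
have nat3 (a : nat) : ((a%:R : 'Z_3) : nat) = (a %% 3)%N by rewrite val_Zp_nat.
split.
  move=> [[a m] <-]; rewrite /fat_set; apply/andP; split.
    apply/forallP => i; rewrite tnth_mktuple /=.
    by have := node_lt3 a i; have := ltn_ord (m i); lia.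
  apply/imsetP; exists a => //; apply/ffunP => i; rewrite !ffunE tnth_mktuple /=.
  by apply: val_inj; rewrite -pmulrn /= !nat3 addnC mulnC modnMDl.
move=> /andP[/forallP v0 /imsetP[a _ va]].
exists (a, [ffun i => inord (`|tnth v i| %/ 3)]).
apply: eq_from_tnth => i; rewrite tnth_mktuple ffunE /=.
have /andP[vi0 vin] := v0 i.
have := congr1 (fun f : {ffun 'I_d -> 'Z_3} => f i : nat) va.
rewrite !ffunE; case: (tnth v i) vi0 vin => // w _ wn; rewrite -pmulrn !nat3.
rewrite (modn_small (node_lt3 a i)) => wa.
rewrite inordK; first by rewrite -wa addnC mulnC -divn_eq.
by rewrite ltn_divLR // mulnC.
Qed.

Lemma node_inj (a b : nat) : (a < 6)%N -> (b < 6)%N ->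
  (forall i, (i < 4)%N -> node a i = node b i) -> a = b.
Proof.
have /allP h : all (fun a => all (fun b =>
    [&& node a 0 == node b 0, node a 1 == node b 1, node a 2 == node b 2 &
        node a 3 == node b 3] ==> (a == b)) (iota 0 6)) (iota 0 6) by vm_compute.
move=> a6 b6 ab.
have a7 : a \in iota 0 6 by rewrite mem_iota.
have b7 : b \in iota 0 6 by rewrite mem_iota.
have /allP /(_ _ b7) /implyP := h _ a7.
by rewrite !ab // !eqxx => /(_ isT) /eqP.
Qed.

Lemma card_residues : #|residues| = 6.
Proof.
rewrite card_imset ?card_ord // => a b /ffunP ab; apply: val_inj.
apply: (node_inj (ltn_ord a) (ltn_ord b)) => i i4.
have nat3 (c : nat) : ((c%:R : 'Z_3) : nat) = (c %% 3)%N by rewrite val_Zp_nat.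
have := congr1 (fun z : 'Z_3 => z : nat) (ab (Ordinal (leq_trans i4 d4))).
by rewrite !ffunE !nat3 !modn_small ?node_lt3.
Qed.

Definition points (j : 'I_#|{: idx}|) : d.-tuple int := point (enum_val j).
Definition frequencies (j : 'I_#|{: idx}|) : rvec R d := frequency (enum_val j).

Lemma card_idx : #|{: idx}| = (6 * n ^ d)%N.
Proof. by rewrite card_prod card_ffun !card_ord. Qed.

Lemma points_orth p q :
  \sum_j e1 (dotp (int_rvec R (points j)) (frequencies p) -
             dotp (int_rvec R (points j)) (frequencies q)) =
  (#|{: idx}| * (p == q))%:R :> C.
Proof.
transitivity ((6 * n ^ d * (enum_val p == enum_val q))%:R : C).
  rewrite -point_frequency_orth.
  by rewrite [RHS](reindex _ (onW_bij _ (@enum_val_bij _))).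
by rewrite (inj_eq enum_val_inj) -[in LHS]card_idx.
Qed.

Lemma fat_set_points (v : d.-tuple int) :
  (exists j, points j = v) <-> fat_set n residues v.
Proof.
split; first by move=> [j jv]; apply/fat_set_point; exists (enum_val j).
move=> /fat_set_point[x xv]; exists (enum_rank x).
by rewrite /points enum_rankK.
Qed.

End example.

(** The difference of the d-th powers of 3n + 2 and 3n - 2 is of order
    n ^ (d - 1), hence negligible against n ^ d for large n. *)
Lemma exists_small_collar (R : realType) (d : nat) : exists N,
  2 ^+ d * (((3 * N.+1)%:R + 2) ^+ d - ((3 * N.+1)%:R - 2) ^+ d) <
  (6 * N.+1 ^ d)%:R :> R.
Proof.
case: d => [|d]; first by exists 0%N; rewrite !expr0 subrr mulr0 ltr0n.
pose N := (2 ^ d.+1 * (4 * d.+1 * 5 ^ d)).-1.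
have N1 : N.+1 = (2 ^ d.+1 * (4 * d.+1 * 5 ^ d))%N.
  by rewrite prednK // !muln_gt0 !expn_gt0.
exists N; move: (N.+1) N1 (ltn0Sn N) => n N1 n0.
have n1 : 1 <= n%:R :> R by rewrite ler1n.
rewrite subrXX (_ : _ + 2 - _ = 4); last by rewrite natrM; ring.
apply: (@le_lt_trans _ _ (2 ^+ d.+1 * (4 * (d.+1%:R * (5 * n%:R) ^+ d)))).
  rewrite ler_wpM2l ?exprn_ge0 // ler_wpM2l //.
  have -> : d.+1%:R * (5 * n%:R) ^+ d = \sum_(i < d.+1) (5 * n%:R) ^+ d :> R.
    by rewrite sumr_const card_ord mulr_natl.
  apply: ler_sum => i _.
  have id : (i <= d)%N by rewrite -ltnS.
  rewrite /= -[in leRHS](subnK id) exprD.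
  apply: ler_pM; rewrite ?exprn_ge0 //.
  - by rewrite natrM; lra.
  - by apply: lerXn2r; rewrite ?nnegrE ?natrM; lra.
  - by apply: lerXn2r; rewrite ?nnegrE ?natrM; lra.
rewrite exprMn.
have -> : 2 ^+ d.+1 * (4 * (d.+1%:R * (5 ^+ d * n%:R ^+ d))) =
    n%:R ^+ d.+1 :> R.
  have nE : n%:R = 2 ^+ d.+1 * (4 * (d.+1%:R * 5 ^+ d)) :> R.
    by rewrite N1 !natrM !natrX; ring.
  by rewrite [RHS]exprS {2}nE; ring.
rewrite natrM natrX ltr_pMl ?exprn_gt0 ?ltr0n // ltr1n //.
Qed.

Theorem theorem3p1 (R : realType) (d : nat) (hd : (4 <= d)%N) :
  exists (k : nat) (s : 'I_k -> d.-tuple int),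
    [/\ (1 <= k)%N,
        spectral (cube_union R s) &
        ~ tile (cube_union R s)].
Proof.
have [N big] := exists_small_collar R d.
have k0 : (0 < #|{: 'I_6 * {ffun 'I_d -> 'I_N.+1}}|)%N.
  by rewrite card_idx muln_gt0 expn_gt0.
have orth := @points_orth R d N hd.
exists #|{: 'I_6 * {ffun 'I_d -> 'I_N.+1}}|, (@points d N); split => //.
  exact: (spectral_cube_union k0 orth).
apply: (@not_tile_fat_union R d N.+1 (residues d)) => //.
- exact: (orth_inj k0 orth).
- exact: fat_set_points.
- by rewrite card_residues.
- by rewrite card_idx.
Qed.
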